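(* The standard symplectic $\mathbb{R}^8$ admits uncountably many pairwise smoothly distinct (i.e. pairwise not smoothly equivalent) smooth foliations all of whose leaves are Lagrangian submanifolds diffeomorphic to $\mathbb{R}^4$ with its standard smooth structure.
   Context: The standard symplectic form on $\mathbb{R}^8$ with coordinates $x_1,\dots,x_4,y_1,\dots,y_4$ is $\omega=\sum_{i=1}^4 dx_i\wedge dy_i$. A Lagrangian submanifold $L$ of a symplectic manifold $(V^{2n},\omega)$ is a submanifold of dimension $n$ with $\omega|_L\equiv 0$. Two smooth manifolds with smooth foliations $(X_0,\mathcal{F}_0)$ and $(X_1,\mathcal{F}_1)$ are smoothly equivalent if there exists a diffeomorphism $\phi:X_0\to X_1$ with $\phi_*(\mathcal{F}_0)=\mathcal{F}_1$; here $X_0=X_1=\mathbb{R}^8$ and the diffeomorphism is not required to be symplectic. *)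

(* Defs.v *)
(* MathComp-Analysis; R^n is the space of row vectors 'rV[R]_n over a realType R. *)
From Stdlib Require Export Relation_Operators.
From mathcomp Require Export all_boot all_order all_algebra.
From mathcomp Require Export all_classical all_reals all_analysis.

Set Implicit Arguments.
Unset Strict Implicit.
Unset Printing Implicit Defensive.

Export Order.TTheory GRing.Theory Num.Theory.
Export numFieldNormedType.Exports.

Local Open Scope classical_set_scope.
Local Open Scope ring_scope.

(* The mixed partial derivative of f along the coordinate axes listed in s, the
   last axis of s being differentiated first. *)
Definition iter_partial (R : realType) (m n : nat) (s : seq 'I_m)
    (f : 'rV[R]_m -> 'rV[R]_n) : 'rV[R]_m -> 'rV[R]_n :=
  foldr (fun i g x => 'D_(delta_mx ord0 i) g x) f s.

(* C^oo on U, meant for open U: only the germs of f at points of U matter. *)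
Definition smooth (R : realType) (m n : nat) (U : set 'rV[R]_m)
    (f : 'rV[R]_m -> 'rV[R]_n) : Prop :=
  forall (s : seq 'I_m) (x : 'rV[R]_m), U x ->
    {for x, continuous (iter_partial s f)} /\
    forall i : 'I_m, derivable (iter_partial s f) x (delta_mx ord0 i).

(* Smoothness of a map on an arbitrary subset X of R^m: near each point of X it
   has a smooth extension to an open neighbourhood in R^m. For open X this is
   [smooth X f]. The values of f outside X are irrelevant. *)
Definition smooth_on (R : realType) (m n : nat) (X : set 'rV[R]_m)
    (f : 'rV[R]_m -> 'rV[R]_n) : Prop :=
  forall x, X x -> exists (U : set 'rV[R]_m) (F : 'rV[R]_m -> 'rV[R]_n),
    [/\ open U, U x, smooth U F & forall y, U y -> X y -> F y = f y].

Definition diffeomorphism (R : realType) (m n : nat) (X : set 'rV[R]_m)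
    (Y : set 'rV[R]_n) (f : 'rV[R]_m -> 'rV[R]_n) : Prop :=
  set_bij X Y f /\ smooth_on X f /\
  exists g : 'rV[R]_n -> 'rV[R]_m, {in X, cancel f g} /\ smooth_on Y g.

Definition diffeomorphic (R : realType) (m n : nat) (X : set 'rV[R]_m)
    (Y : set 'rV[R]_n) : Prop :=
  exists f : 'rV[R]_m -> 'rV[R]_n, diffeomorphism X Y f.

(* g : U -> L is a local parametrization of L, U open in R^d: a diffeomorphism
   onto a relatively open part of L. *)
Definition parametrization (R : realType) (d n : nat) (L : set 'rV[R]_n)
    (U : set 'rV[R]_d) (g : 'rV[R]_d -> 'rV[R]_n) : Prop :=
  open U /\
  exists W : set 'rV[R]_n, open W /\ diffeomorphism U (L `&` W) g.

(* Embedded (not necessarily closed) d-dimensional submanifolds of R^n. *)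
Definition submanifold (R : realType) (d n : nat) (L : set 'rV[R]_n) : Prop :=
  forall x, L x -> exists (U : set 'rV[R]_d) (g : 'rV[R]_d -> 'rV[R]_n),
    parametrization L U g /\ (g @` U) x.

(* The tangent space at x to a d-dimensional submanifold L: the image of the
   differential of a local parametrization. *)
Definition tangent_space (R : realType) (d n : nat) (L : set 'rV[R]_n)
    (x : 'rV[R]_n) : set 'rV[R]_n :=
  [set v | exists (U : set 'rV[R]_d) (g : 'rV[R]_d -> 'rV[R]_n) (u w : 'rV[R]_d),
    [/\ parametrization L U g, U u, g u = x & 'D_w g u = v]].

(* omega = \sum_i dx_i /\ dy_i on R^(2n) (constant in the base point): the x_i
   are the first n coordinates and the y_i the last n. *)
Definition omega (R : realType) (n : nat) (v w : 'rV[R]_(n + n)) : R :=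
  \sum_(i < n) (v ord0 (lshift n i) * w ord0 (rshift n i)
              - v ord0 (rshift n i) * w ord0 (lshift n i)).

Definition lagrangian (R : realType) (n : nat) (L : set 'rV[R]_(n + n)) : Prop :=
  submanifold n L /\
  forall x v w, L x -> tangent_space n L x v -> tangent_space n L x w ->
    omega v w = 0.

(* Foliations of R^(p + q) with p-dimensional leaves, by foliated atlases.
   A foliated chart (U, phi) identifies U with a product of (possibly
   unbounded) open intervals; its plaques are the level sets of the last q
   coordinates of phi. *)
Definition foliated_chart (R : realType) (p q : nat) (U : set 'rV[R]_(p + q))
    (phi : 'rV[R]_(p + q) -> 'rV[R]_(p + q)) : Prop :=
  open U /\
  exists J : 'I_(p + q) -> interval R,
    (forall i, open [set` J i]) /\
    diffeomorphism U [set z | forall i, z ord0 i \in J i] phi.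

Definition plaque (R : realType) (p q : nat) (U : set 'rV[R]_(p + q))
    (phi : 'rV[R]_(p + q) -> 'rV[R]_(p + q)) (x : 'rV[R]_(p + q)) :
    set 'rV[R]_(p + q) :=
  [set y | [/\ U x, U y & rsubmx (phi x) = rsubmx (phi y)]].

(* The last clause is coherence: plaques of two charts of the atlas meet in a
   relatively open subset of each of them. As the two charts may be exchanged,
   openness in the first plaque suffices. *)
Definition foliated_atlas (R : realType) (p q : nat)
    (A : set (set 'rV[R]_(p + q) * ('rV[R]_(p + q) -> 'rV[R]_(p + q)))) : Prop :=
  [/\ forall c, A c -> foliated_chart c.1 c.2,
      forall x, exists2 c, A c & c.1 x
    & forall c d, A c -> A d -> forall x y,
        exists O : set 'rV[R]_(p + q), open O /\
          plaque c.1 c.2 x `&` plaque d.1 d.2 y = plaque c.1 c.2 x `&` O].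

(* The leaf through x consists of the points joined to x by a finite chain of
   plaques, consecutive ones intersecting. *)
Definition leaf (R : realType) (p q : nat)
    (A : set (set 'rV[R]_(p + q) * ('rV[R]_(p + q) -> 'rV[R]_(p + q))))
    (x : 'rV[R]_(p + q)) : set 'rV[R]_(p + q) :=
  clos_refl_sym_trans 'rV[R]_(p + q)
    (fun y z => exists2 c, A c & plaque c.1 c.2 y z) x.

(* A foliation is represented by the partition of R^(p + q) into its leaves,
   which determines it. *)
Definition smooth_foliation (R : realType) (p q : nat)
    (F : set (set 'rV[R]_(p + q))) : Prop :=
  exists A : set (set 'rV[R]_(p + q) * ('rV[R]_(p + q) -> 'rV[R]_(p + q))),
    foliated_atlas A /\ F = range (leaf A).

Definition smoothly_equivalent (R : realType) (n : nat)
    (F0 F1 : set (set 'rV[R]_n)) : Prop :=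
  exists phi : 'rV[R]_n -> 'rV[R]_n,
    diffeomorphism setT setT phi /\ [set phi @` L | L in F0] = F1.

(* Main.v *)
(* Let h : R^2 -> R be smooth. The functions f = h(x_1, y_2) + exp(y_1), y_2, y_3,
   y_4 Poisson commute and are independent everywhere, and
   (x_1, ..., y_4) |-> (x_1, ..., x_4, f, y_2, y_3, y_4) is a diffeomorphism of
   R^8 onto the region {f > h(x_1, y_2)}. The leaves are the connected components
   of the common level sets; with c the value of f and l that of y_2, they
   correspond to the components of {x_1 | h(x_1, l) < c}, times R^3. Hence they
   are Lagrangian and diffeomorphic to R^4.

   Two leaves cannot be separated in the leaf space iff they lie on the same
   common level set and h(., l) <= c on the gap between their x_1-components, so
   the set of cardinals of the classes of mutually non-separated leaves is a
   homeomorphism invariant that can be read off h. Take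
     h(x, l) = w(l) t + cos t,   t = e^l x' with x' = 1 / (1 + e^(-x)),
     w(l) = sin(e^l / (2 al)).
   When w(l) <> 0 no two local maxima of h(., l) have the same height, and a
   class has at most two leaves. When w(l) = 0, i.e. e^l = 2 pi al m with m >= 1,
   the maxima of cos on (0, e^l) all have height 1, and the class at c = 1
   consists of the ceil(al m) components of (0, e^l) minus 2 pi Z. So the
   cardinals > 2 are the Beatty numbers ceil(al m), which determine al >= 3. *)
Require Import Defs.
From mathcomp Require Import ring lra.

Set Implicit Arguments.
Unset Strict Implicit.
Unset Printing Implicit Defensive.

Local Open Scope classical_set_scope.
Local Open Scope ring_scope.

(** * Smooth functions *)

Section Smoothness.
Variables (R : realType) (m : nat).
Implicit Types (U : set 'rV[R]_m) (f g : 'rV[R]_m -> R) (e : R -> R).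

Local Notation ax i := (delta_mx ord0 i : 'rV[R]_m).

(* Partial derivatives are peeled off on the inside here, and on the outside in
   [iter_partial]: closure under products and composition is then an induction
   on k. *)
Fixpoint Ck (k : nat) U f : Prop :=
  (forall x, U x -> {for x, continuous f}) /\
  if k is k'.+1 then
    forall i, (forall x, U x -> derivable f x (ax i)) /\
              Ck k' U (fun x => 'D_(ax i) f x)
  else True.

Definition Cinf U f := forall k, Ck k U f.

Lemma near_eq_open U f g x : open U -> {in U, f =1 g} -> U x ->
  \near x, f x = g x.
Proof.
move=> oU fg Ux; near=> y; apply: fg; rewrite inE; near: y.
exact: open_nbhs_nbhs.
Unshelve. all: by end_near. Qed.

Lemma continuous_near_eq f g x :
  (\near x, f x = g x) -> {for x, continuous f} -> {for x, continuous g}.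
Proof.
move=> fg fc; rewrite /prop_for /continuous_at -(nbhs_singleton fg).
exact: cvg_trans (near_eq_cvg fg) fc.
Qed.

(** The formulas for derivatives of sums, products and composites hold on U only. As U is open, they
    hold near each of its points, which is all that further derivatives see. *)
Lemma Ck_ext k U f g : open U -> {in U, f =1 g} -> Ck k U f -> Ck k U g.
Proof.
move=> oU; elim: k f g => [|k IH] f g fg [fc fk];
  (have fgn x (Ux : U x) : \near x, f x = g x by exact: near_eq_open fg Ux);
  (have gc x (Ux : U x) := continuous_near_eq (fgn x Ux) (fc x Ux));
  split => // i; have [fd fD] := fk i.
split=> [x Ux|]; first by apply: near_eq_derivable (fd x Ux); exact: fgn.
by apply: IH fD => x /[1!inE] Ux; apply: near_eq_derive; exact: fgn.
Qed.

Lemma Ck_cst k U (c : R) : Ck k U (fun=> c).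
Proof.
elim: k c => [|k IH] c; (split; first by move=> x _; exact: cst_continuous) => // i.
split=> [x _|]; first exact: derivable_cst.
have -> : (fun x => 'D_(ax i) (fun=> c) x) = (fun=> 0); last exact: IH.
by apply/funext => x; exact: derive_cst.
Qed.

Lemma is_derive_coord (x v : 'rV[R]_m) j :
  is_derive x v (fun y : 'rV[R]_m => y ord0 j) (v ord0 j).
Proof.
have dj : differentiable (fun y : 'rV[R]_m => y ord0 j) x.
  exact: differentiable_coord.
apply: DeriveDef; first exact: diff_derivable.
have d : derivable id x v by exact: derivable_id.
by have := derive_mx d; rewrite derive_id => /(congr1 (fun M : 'rV[R]_m => M ord0 j));
  rewrite mxE.
Qed.

Lemma Ck_coord k U j : Ck k U (fun x => x ord0 j).
Proof.
case: k => [|k]; (split; first by move=> x _; exact: coord_continuous) => // i.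
split=> [x _|]; first exact: (@ex_derive _ _ _ _ _ _ _ (is_derive_coord _ _ _)).
have -> : (fun x => 'D_(ax i) (fun x : 'rV_m => x ord0 j) x) = (fun=> ax i ord0 j).
  by apply/funext => x; rewrite (@derive_val _ _ _ _ _ _ _ (is_derive_coord _ _ _)).
exact: Ck_cst.
Qed.

Lemma CkS k U f : Ck k.+1 U f -> Ck k U f.
Proof.
elim: k f => [|k IH] f [fc fk]; split => // i.
by have [fd fD] := fk i; split=> //; exact: IH.
Qed.

Lemma CkD k U f g : open U -> Ck k U f -> Ck k U g ->
  Ck k U (fun x => f x + g x).
Proof.
move=> oU; elim: k f g => [|k IH] f g [fc fk] [gc gk];
  (split; first by move=> x Ux; exact: (continuousD (fc x Ux) (gc x Ux))) => // i.
have [[fd fD] [gd gD]] := (fk i, gk i).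
split=> [x Ux|]; first by apply: derivableD; [exact: fd|exact: gd].
apply: Ck_ext (IH _ _ fD gD) => // x /[1!inE] Ux.
by rewrite [in RHS]deriveD//; [exact: fd|exact: gd].
Qed.

Lemma CkM k U f g : open U -> Ck k U f -> Ck k U g ->
  Ck k U (fun x => f x * g x).
Proof.
move=> oU; elim: k f g => [|k IH] f g.
  by move=> [fc _] [gc _]; split=> // x Ux; exact: (continuousM (fc x Ux) (gc x Ux)).
move=> fS gS; have [[fc fk] [gc gk]] := (fS, gS).
split=> [x Ux|i]; first by exact: (continuousM (fc x Ux) (gc x Ux)).
have [[fd fD] [gd gD]] := (fk i, gk i).
split=> [x Ux|]; first by apply: derivableM; [exact: fd|exact: gd].
have := CkD oU (IH _ _ (CkS fS) gD) (IH _ _ (CkS gS) fD).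
apply: Ck_ext => // x /[1!inE] Ux.
by rewrite [in RHS]deriveM//; [exact: fd|exact: gd].
Qed.

(** Reduces directional derivatives to one real variable, where the chain rule applies. *)
Lemma is_derive_line f (x v : 'rV[R]_m) (a : R) :
  is_derive x v f a <-> is_derive (0 : R) 1 (fun h : R => f (h *: v + x)) a.
Proof.
have dE : 'D_v f x = 'D_1 (fun h : R => f (h *: v + x)) 0.
  rewrite /derive; set g1 := fun h => h^-1 *: _; set g2 := fun h => h^-1 *: _.
  suff -> : g1 = g2 by [].
  by apply/funext => h; rewrite /g1 /g2 /= addr0 scale0r add0r [_%:A]mulr1.
split=> [[fd fa]|[fd fa]]; apply: DeriveDef.
- exact: (derivable1P f x v).1 fd.
- by rewrite -dE.
- exact: (derivable1P f x v).2 fd.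
- by rewrite dE.
Qed.

Lemma is_derive_comp e f (x v : 'rV[R]_m) (a : R) :
  is_derive (f x) 1 e a -> derivable f x v ->
  is_derive x v (fun y => e (f y)) (a * 'D_v f x).
Proof.
move=> ea /derivableP/is_derive_line fd; apply/is_derive_line.
rewrite -[fun h : R => _]/(e \o (fun h : R => f (h *: v + x))).
by apply: is_derive1_comp; rewrite scale0r add0r.
Qed.

(* E is a class of functions stable under differentiation on W. *)
Lemma Ck_comp (W : set R) (E : set (R -> R)) U : open U ->
  (forall e, E e -> exists2 e', E e' & forall y, W y -> is_derive y 1 e (e' y)) ->
  forall k f e, Ck k U f -> (forall x, U x -> W (f x)) -> E e ->
  Ck k U (fun x => e (f x)).
Proof.
move=> oU EW.
have ec e y : E e -> W y -> {for y, continuous e}.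
  move=> /EW[e' _ ee'] /ee' [ed _].
  exact/differentiable_continuous/derivable1_diffP.
elim=> [|k IH] f e fS fW Ee; have [e' Ee' de] := EW e Ee; have [fc fk] := fS;
  (split; first by move=> x Ux; apply: continuous_comp;
     [exact: fc|by apply: ec => //; exact: fW]) => // i.
have [fd fD] := fk i.
have dcomp x (Ux : U x) := is_derive_comp (de _ (fW _ Ux)) (fd _ Ux).
split=> [x Ux|]; first by have [] := dcomp x Ux.
apply: Ck_ext (CkM oU (IH _ _ (CkS fS) fW Ee') fD) => // x /[1!inE] Ux.
by rewrite [in RHS](@derive_val _ _ _ _ _ _ _ (dcomp x Ux)).
Qed.

Lemma Cinf_cst U c : Cinf U (fun=> c). Proof. by move=> k; exact: Ck_cst. Qed.

Lemma Cinf_coord U j : Cinf U (fun x => x ord0 j).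
Proof. by move=> k; exact: Ck_coord. Qed.

Lemma CinfD U f g : open U -> Cinf U f -> Cinf U g -> Cinf U (fun x => f x + g x).
Proof. by move=> oU fU gU k; exact: CkD. Qed.

Lemma CinfM U f g : open U -> Cinf U f -> Cinf U g -> Cinf U (fun x => f x * g x).
Proof. by move=> oU fU gU k; exact: CkM. Qed.

Lemma CinfN U f : open U -> Cinf U f -> Cinf U (fun x => - f x).
Proof.
move=> oU fU; rewrite (_ : (fun _ => _) = (fun x => -1 * f x)).
  by apply: CinfM => //; exact: Cinf_cst.
by apply/funext => x; rewrite mulN1r.
Qed.

Lemma Cinf_expR U f : open U -> Cinf U f -> Cinf U (fun x => expR (f x)).
Proof.
move=> oU fU k; apply: (@Ck_comp setT [set @expR R]) => // e ->.
by exists expR => // y _; exact: is_derive_expR.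
Qed.

Lemma Cinf_cos_sin U f : open U -> Cinf U f ->
  Cinf U (fun x => cos (f x)) /\ Cinf U (fun x => sin (f x)).
Proof.
move=> oU fU.
(* The span of sine and cosine is stable under differentiation and serves for both functions at
   once. *)
pose E : set (R -> R) := [set e | exists a b : R, e = a *: (@sin R) + b *: (@cos R)].
have EE e : E e -> exists2 e', E e' & forall y : R, setT y -> is_derive y 1 e (e' y).
  move=> [a [b ->]]; exists ((- b) *: (@sin R) + a *: (@cos R)).
    by exists (- b), a.
  move=> y _.
  have H : is_derive y 1 (a *: (@sin R) + b *: (@cos R))
     (a *: cos y + b *: - sin y) by apply: is_deriveD.
  by apply: (is_derive_eq H); rewrite addrC scalerN -scaleNr.
split => k.
- apply: (Ck_comp oU EE) => //; exists 0, 1.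
  by rewrite scale0r add0r scale1r.
- apply: (Ck_comp oU EE) => //; exists 1, 0.
  by rewrite scale0r addr0 scale1r.
Qed.

Lemma Cinf_ln U f : open U -> (forall x, U x -> 0 < f x) -> Cinf U f ->
  Cinf U (fun x => ln (f x)).
Proof.
move=> oU f0 fU k.
(* [inv n] is the power y^-(n+1). The multiples of these powers, joined by the logarithm, are stable
   under differentiation on the positive half-line. *)
pose inv n : R -> R := fun y => (y^-1) ^+ n.+1.
pose E : set (R -> R) :=
  [set e | e = @ln R \/ exists (a : R) n, e = a *: inv n].
apply: (@Ck_comp [set y | 0 < y] E) => //; last by left.
move=> e [->|[a [n ->]]].
  exists (1 *: inv 0%N); first by right; exists 1, 0%N.
  move=> y y0; apply: is_derive_eq; first exact: is_derive1_ln.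
  by rewrite scale1r /inv expr1.
exists ((- (a * n.+1%:R)) *: inv n.+1); first by right; exists (- (a * n.+1%:R)), n.+1.
move=> y y0; have yN0 : y != 0 by rewrite gt_eqF.
have dV : is_derive y 1 (fun z : R => z^-1) (- y ^- 2 *: 1).
  exact: (@is_deriveV _ idfun).
have invE : inv n = (fun z : R => z^-1) ^+ n.+1.
  by apply/funext => z; rewrite exprfctE.
rewrite [in X in is_derive _ _ X _]invE.
have := is_deriveZ a (is_deriveX n.+1 dV) => /is_derive_eq; apply.
change (a * (n.+1%:R * y^-1 ^+ n * (- y ^- 2 * 1)) =
        - (a * n.+1%:R) * y^-1 ^+ n.+2).
by rewrite mulr1 !mulrN mulNr -!mulrA -exprVn -exprD addn2.
Qed.

End Smoothness.

(** * Smooth vector-valued maps, coordinate by coordinate *)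

Section VectorSmoothness.
Variables (R : realType) (m n : nat).

Lemma Cinf_iter_partial (U : set 'rV[R]_m) (f : 'rV[R]_m -> R) (s : seq 'I_m) :
  Cinf U f ->
  Cinf U (foldr (fun i g x => 'D_(delta_mx ord0 i) g x) f s).
Proof.
move=> fU; elim: s => //= i s IH k.
by have [_ /(_ i)[]] := IH k.+1.
Qed.

Lemma continuous_rV (T : topologicalType) (f : T -> 'rV[R]_n) (x : T) :
  (forall j, {for x, continuous (fun y => f y ord0 j)}) ->
  {for x, continuous f}.
Proof.
move=> fc; apply/cvgrPdist_le => e e0; near=> y.
rewrite /Num.Def.normr/= mx_normrE (bigmax_le _ (ltW e0))//= => -[i j] _.
rewrite ord1 !mxE /=.
move: j; near: y; apply: filter_forall => j.
by move/cvgrPdist_le : (fc j); apply.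
Unshelve. all: by end_near. Qed.

(** On U the coordinates of an iterated partial derivative of f are the iterated partial derivatives
    of its coordinates. The induction on s carries derivability along: it is what allows the next
    derivative to be computed coordinatewise. *)
Lemma smooth_coords (U : set 'rV[R]_m) (f : 'rV[R]_m -> 'rV[R]_n) : open U ->
  (forall j, Cinf U (fun x => f x ord0 j)) -> smooth U f.
Proof.
move=> oU fU.
pose it j s := foldr (fun i g x => 'D_(delta_mx ord0 i) g x)
  (fun x => f x ord0 j) s.
have itC j s : Cinf U (it j s) by exact: Cinf_iter_partial.
have cderE s (H : forall x j, U x -> iter_partial s f x ord0 j = it j s x) x :
    U x -> {for x, continuous (iter_partial s f)} /\
    forall i : 'I_m, derivable (iter_partial s f) x (delta_mx ord0 i).
  move=> Ux.
  have nE j : \near x, it j s x = iter_partial s f x ord0 j.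
    by apply: near_eq_open Ux => // y /[1!inE] Uy; rewrite H.
  split=> [|i].
    apply: continuous_rV => j.
    exact: continuous_near_eq (nE j) ((itC j s 0%N).1 x Ux).
  apply/derivable_mxP => k j; rewrite ord1.
  by apply: near_eq_derivable (nE j) _; have [_ /(_ i)[d _]] := itC j s 1%N; exact: d.
suff itE s x j : U x -> iter_partial s f x ord0 j = it j s x.
  by move=> s x Ux; apply: cderE => // y j; exact: itE.
elim: s x j => [//|i s IH] x j Ux /=.
have [_ /(_ i) d] := cderE s IH x Ux.
rewrite (derive_mx d) mxE; apply: near_eq_derive.
by apply: near_eq_open Ux => // y /[1!inE] Uy; rewrite IH.
Qed.

Lemma Cinf_sub (U W : set 'rV[R]_m) f : U `<=` W -> Cinf W f -> Cinf U f.
Proof.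
move=> UW fW k; elim: k f fW => [|k IH] f fW;
  (split; first by move=> x /UW; exact: (fW 0%N).1) => // i.
split=> [x /UW|]; first by have [_ /(_ i)[+ _]] := fW 1%N; apply.
by apply: IH => l; have [_ /(_ i)[]] := fW l.+1.
Qed.

Lemma Cinf_continuous (f : 'rV[R]_m -> R) : Cinf setT f -> continuous f.
Proof. by move=> /(_ 0%N)[+ _] x; apply. Qed.

Lemma continuous_smooth (f : 'rV[R]_m -> 'rV[R]_n) :
  smooth setT f -> continuous f.
Proof. by move=> fs x; have [] := fs [::] x. Qed.

Lemma smooth_smooth_on (X U : set 'rV[R]_m) (f : 'rV[R]_m -> 'rV[R]_n) :
  open U -> X `<=` U -> smooth U f -> smooth_on X f.
Proof. by move=> oU XU fU x /XU Ux; exists U, f; split. Qed.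

Lemma smooth_on_continuous (f : 'rV[R]_m -> 'rV[R]_n) :
  smooth_on setT f -> continuous f.
Proof.
move=> fs x; have [U [F [oU Ux FU FE]]] := fs x I.
have [Fc _] := FU [::] x Ux.
have Ff : \near x, F x = f x.
  near=> y; apply: FE => //; near: y; exact: open_nbhs_nbhs.
rewrite /continuous_at -(nbhs_singleton Ff).
exact: cvg_trans (near_eq_cvg Ff) Fc.
Unshelve. all: by end_near. Qed.

(* The junk value of a directional derivative that does not exist: [tangent_space]
   contains no spurious vector other than 0. *)
Lemma derive_nderivable (f : 'rV[R]_m -> 'rV[R]_n) x v :
  ~ derivable f x v -> 'D_v f x = 0.
Proof. by move=> nd; rewrite /derive dvgP//; apply/matrixP => i j; rewrite !mxE. Qed.

End VectorSmoothness.

Lemma Cinf_derivable (R : realType) (f : R -> R) x :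
  Cinf setT (fun v : 'rV[R]_1 => f (v ord0 ord0)) -> derivable f x 1.
Proof.
move=> /(_ 1%N)[_ /(_ ord0)[/(_ (const_mx x) I) df _]].
have dg := (is_derive_line _ _ _ _).1 (derivableP df).
have {}df : derivable (f \o shift x) (0 : R) 1.
  have [+ _] := dg; rewrite (_ : (fun _ => _) = f \o shift x)//.
  by apply/funext => t; rewrite !mxE mulr1.
move: df; rewrite /derivable (_ : (fun _ => _) =
  (fun t => t^-1 *: (f (t *: 1 + x) - f x)))//.
by apply/funext => t; rewrite /= addr0 add0r.
Qed.

(** * The foliation defined by h *)

Section Between.
Variable R : realType.
Implicit Types a b c s : R.

Definition btw a b s := (a <= s <= b) || (b <= s <= a).

Lemma btwl a b : btw a b a.
Proof. by rewrite /btw lexx /=; case: (lerP a b) => //= /ltW ->. Qed.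

Lemma btwC a b s : btw a b s = btw b a s.
Proof. by rewrite /btw orbC. Qed.

Lemma btwr a b : btw a b b. Proof. by rewrite btwC btwl. Qed.

Lemma btw_split a b c s : btw a c s -> btw a b s || btw b c s.
Proof.
rewrite /btw => /orP[]/andP[h1 h2]; have [sb|/ltW bs] := leP s b.
- by rewrite h1.
- by rewrite bs h2 !orbT.
- by rewrite h1 !orbT.
- by rewrite bs h2 !orbT.
Qed.

End Between.

Section Foliation.
Variables (R : realType) (h : R -> R -> R).
(* Smoothness of h, stated through its composites. *)
Hypothesis h_Cinf : forall (m : nat) (U : set 'rV[R]_m) f g,
  open U -> Cinf U f -> Cinf U g -> Cinf U (fun x => h (f x) (g x)).

Notation V := 'rV[R]_(4 + 4).
(* The coordinates x_1, y_1 and y_2. *)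
Definition ix : 'I_(4 + 4) := lshift 4 ord0.
Definition iy : 'I_(4 + 4) := rshift 4 ord0.
Definition il : 'I_(4 + 4) := rshift 4 (lift ord0 (ord0 : 'I_3)).

Definition upd (z : V) (a : R) : V := \row_j (if j == iy then a else z ord0 j).
(** This is the function f of the overview. [straighten] replaces y_1 by it, so that the last four
    coordinates of [straighten] are the four commuting functions. *)
Definition level (z : V) : R := h (z ord0 ix) (z ord0 il) + expR (z ord0 iy).
Definition straighten (z : V) : V := upd z (level z).
Definition unstraighten (v : V) : V :=
  upd v (ln (v ord0 iy - h (v ord0 ix) (v ord0 il))).
Definition region : set V := [set v | h (v ord0 ix) (v ord0 il) < v ord0 iy].

Lemma upd_iy z a : upd z a ord0 iy = a. Proof. by rewrite mxE eqxx. Qed.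
Lemma upd_ix z a : upd z a ord0 ix = z ord0 ix. Proof. by rewrite mxE. Qed.
Lemma upd_il z a : upd z a ord0 il = z ord0 il. Proof. by rewrite mxE. Qed.

Lemma upd_upd z a b : upd (upd z a) b = upd z b.
Proof. by apply/rowP => j; rewrite !mxE; case: ifP => // ->. Qed.

Lemma upd_id z : upd z (z ord0 iy) = z.
Proof. by apply/rowP => j; rewrite !mxE; case: ifP => // /eqP ->. Qed.

Lemma straightenK : cancel straighten unstraighten.
Proof.
move=> z; rewrite /unstraighten /straighten upd_ix upd_il upd_iy upd_upd.
by rewrite /level addrAC subrr add0r expRK upd_id.
Qed.

Lemma unstraightenK v : region v -> straighten (unstraighten v) = v.
Proof.
move=> Ov; rewrite /straighten /unstraighten upd_upd /level upd_ix upd_il upd_iy.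
by rewrite lnK ?posrE ?subr_gt0// addrC subrK upd_id.
Qed.

Lemma Cinf_h (U : set V) : open U -> Cinf U (fun v => h (v ord0 ix) (v ord0 il)).
Proof. by move=> oU; apply: h_Cinf => //; exact: Cinf_coord. Qed.

Lemma Cinf_upd (U : set V) f : open U -> Cinf U f ->
  forall j, Cinf U (fun v => upd v (f v) ord0 j).
Proof.
move=> oU fU j; have [->|jy] := eqVneq j iy.
  by under eq_fun do rewrite upd_iy.
by under eq_fun do rewrite mxE (negPf jy); exact: Cinf_coord.
Qed.

Lemma Cinf_level (U : set V) : open U -> Cinf U level.
Proof.
move=> oU; apply: CinfD => //; first exact: Cinf_h.
by apply: Cinf_expR => //; exact: Cinf_coord.
Qed.

Lemma smooth_straighten (U : set V) : open U -> smooth U straighten.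
Proof.
by move=> oU; apply: smooth_coords => //; apply: Cinf_upd => //; exact: Cinf_level.
Qed.

Lemma Cinf_gap : Cinf setT (fun v : V => v ord0 iy - h (v ord0 ix) (v ord0 il)).
Proof.
apply: CinfD; [exact: openT|exact: Cinf_coord|].
by apply: CinfN; [exact: openT|apply: Cinf_h; exact: openT].
Qed.

Lemma open_region : open region.
Proof.
rewrite (_ : region = (fun v : V => v ord0 iy - h (v ord0 ix) (v ord0 il)) @^-1`
  [set y | 0 < y]).
  by apply: open_comp; [move=> x _; exact: Cinf_continuous Cinf_gap x|exact: open_gt].
by apply/seteqP; split => v; rewrite /region/= subr_gt0.
Qed.

Lemma smooth_unstraighten : smooth region unstraighten.
Proof.
apply: smooth_coords; first exact: open_region.
apply: Cinf_upd; first exact: open_region.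
apply: Cinf_ln; [exact: open_region|by move=> x; rewrite /region/= subr_gt0|].
exact: Cinf_sub Cinf_gap.
Qed.

Definition box (J : 'I_(4 + 4) -> interval R) : set V :=
  [set z | forall i, z ord0 i \in J i].

(** The image [region] of [straighten] need not be a product of intervals, so the charts are the
    restrictions of this one map to the preimages of the open boxes in [region]. *)
Definition atlas : set (set V * (V -> V)) :=
  [set c | c.2 = straighten /\ exists J, [/\ forall i, open [set` J i], box J `<=` region
    & c.1 = straighten @^-1` box J]].

Lemma open_box J : (forall i, open [set` J i]) -> open (box J).
Proof.
move=> oJ; rewrite openE => z zJ.
have nz i : \forall w \near z, (w : V) ord0 i \in J i.
  exact: (@coord_continuous R 1 (4 + 4) ord0 i z [set` J i]
    (open_nbhs_nbhs (conj (oJ i) (zJ i)))).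
exact: filter_forall nz.
Qed.

Lemma atlas_chart c : atlas c -> foliated_chart c.1 c.2.
Proof.
case: c => U phi [/= -> [J [oJ JOm ->]]]; split.
  apply: open_comp; last exact: open_box.
  by move=> x _; apply: continuous_smooth; apply: smooth_straighten; exact: openT.
exists J; split => //; split; first split.
- by move=> z.
- by move=> x y _ _ /(congr1 unstraighten); rewrite !straightenK.
- move=> v Jv; exists (unstraighten v); last by rewrite unstraightenK//; exact: JOm.
  by rewrite /= unstraightenK//; exact: JOm.
split; first by apply: (@smooth_smooth_on _ _ _ _ setT);
  [exact: openT|by []|apply: smooth_straighten; exact: openT].
exists unstraighten; split; first by move=> z _; exact: straightenK.
by apply: (smooth_smooth_on open_region JOm); exact: smooth_unstraighten.
Qed.

(** Explicit form of the leaf relation, justified by [leafE]: with c the common level and l the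
    common y_2, both x_1-coordinates lie in one component of {s | h s l < c}. *)
Definition same_leaf (z z' : V) : Prop :=
  rsubmx (straighten z) = rsubmx (straighten z') /\
  forall s, btw (z ord0 ix) (z' ord0 ix) s -> h s (z ord0 il) < level z.

Lemma rsub_coord (v w : V) j :
  rsubmx v = rsubmx w -> v ord0 (rshift 4 j) = w ord0 (rshift 4 j).
Proof. by move=> /rowP /(_ j); rewrite !mxE. Qed.

Lemma rsub_level z z' :
  rsubmx (straighten z) = rsubmx (straighten z') -> level z = level z'.
Proof. by move=> /(rsub_coord ord0); rewrite !upd_iy. Qed.

Lemma rsub_il z z' :
  rsubmx (straighten z) = rsubmx (straighten z') -> z ord0 il = z' ord0 il.
Proof. by move=> /(rsub_coord (lift ord0 ord0)); rewrite !upd_il. Qed.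

Lemma lt_level (z : V) : h (z ord0 ix) (z ord0 il) < level z.
Proof. by rewrite ltrDl expR_gt0. Qed.

Lemma same_leaf_refl z : same_leaf z z.
Proof.
split => // s; rewrite /btw orbb => /andP[s1 s2].
by rewrite (_ : s = z ord0 ix) ?lt_level//; apply/eqP; rewrite eq_le s1 s2.
Qed.

Lemma same_leaf_sym z z' : same_leaf z z' -> same_leaf z' z.
Proof.
move=> [e H]; split=> // s; rewrite btwC => /H.
by rewrite (rsub_il e) (rsub_level e).
Qed.

Lemma same_leaf_trans y z x : same_leaf x y -> same_leaf y z -> same_leaf x z.
Proof.
move=> [e H] [e' H']; split; first by rewrite e.
move=> s /(@btw_split _ _ (y ord0 ix))/orP[/H//|/H'].
by rewrite (rsub_il e) (rsub_level e).
Qed.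

(** A box contains, with two points that differ only in their first four coordinates, every point
    obtained by moving x_1 to an intermediate s. That the moved point lies in [region] is the
    required inequality at s. *)
Lemma plaque_same_leaf c z z' : atlas c -> plaque c.1 c.2 z z' -> same_leaf z z'.
Proof.
case: c => U phi [/= -> [J [oJ JOm ->]]] [/= Jz Jz' e]; split => // s bs.
have Jixz := Jz ix; have Jixz' := Jz' ix.
rewrite /straighten !upd_ix in Jixz Jixz'.
have Js : s \in J ix.
  have itv := @interval_is_interval _ (J ix).
  by move: bs => /orP[] /itv; apply.
pose v : V := \row_j (if j == ix then s else straighten z ord0 j).
have : region v.
  by apply: JOm => j; rewrite mxE; case: ifP => [/eqP ->|] //; move: (Jz j).
by rewrite /region/= !mxE /=.
Qed.

Lemma continuous_h : continuous (fun p : R * R => h p.1 p.2).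
Proof.
pose r (p : R * R) : 'rV[R]_2 := \row_j (if j == ord0 then p.1 else p.2).
have rc : continuous r.
  move=> p; apply: continuous_rV => j; rewrite /prop_for /continuous_at.
  under eq_fun do rewrite mxE.
  by rewrite mxE; case: ifP => _; [exact: cvg_fst|exact: cvg_snd].
have hc : continuous (fun v : 'rV[R]_2 => h (v ord0 ord0) (v ord0 ord_max)).
  apply: Cinf_continuous; apply: h_Cinf; [exact: openT|exact: Cinf_coord..].
have -> : (fun p : R * R => h p.1 p.2) =
    (fun v : 'rV[R]_2 => h (v ord0 ord0) (v ord0 ord_max)) \o r.
  by apply/funext => p; rewrite /= !mxE.
by move=> p; exact: continuous_comp (rc p) (hc _).
Qed.

(** By compactness of [a, b] the strict inequality survives perturbations of all three variables of
    a size e that does not depend on s. *)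
Lemma tube (a b l c : R) :
  (forall s, s \in `[a, b] -> h s l < c) ->
  exists2 e : R, 0 < e & forall s s' l' c', s \in `[a, b] -> `|s - s'| < e ->
    `|l - l'| < e -> `|c - c'| < e -> h s' l' < c'.
Proof.
move=> H.
pose P (e : R) (s : R) := forall s' l' c', `|s - s'| < e ->
    `|l - l'| < e -> `|c - c'| < e -> h s' l' < c'.
suff : \forall e \near (0 : R)^'+, [set` `[a, b]] `<=` P e.
  move=> PF; have : \forall e \near (0 : R)^'+, 0 < e /\ [set` `[a, b]] `<=` P e.
    by apply: filterI => //; exact: nbhs_right_gt.
  by move=> /filter_ex[e [e0 He]]; exists e => // s s' l' c' /He; apply.
have nc := (compact_near_coveringP _).1 (@segment_compact R a b).
apply: (nc R _ P) => //.
move=> x xab.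
pose gap (q : R * R * R) := q.2 - h q.1.1 q.1.2.
have gapc : continuous gap.
  move=> q; apply: cvgB; first exact: cvg_snd.
  have c1 : {for q, continuous (@fst (R * R) R)} by exact: cvg_fst.
  exact: (@continuous_comp _ _ _ _ (fun p : R * R => h p.1 p.2) _ c1 (@continuous_h (fst q))).
have : nbhs (x, l, c) (gap @^-1` [set y | 0 < y]).
  by apply: gapc; apply: open_nbhs_nbhs; split;
    [exact: open_gt|rewrite /= /gap subr_gt0; exact: H].
move=> /nbhs_ballP[d /= d0 dW].
(* Half of the radius d is spent on moving from x to x' in the segment, the other half on moving
   from x' to s'. *)
exists (ball x (d / 2), [set e | e < d / 2]).
  by split => /=; [apply: nbhsx_ballx; lra|apply: nbhs_right_lt; lra].
move=> [x' e] [/= xx' ed] s' l' c' sx ll cc.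
have {}xx' : `|x - x'| < d / 2 by [].
have b1 : `|x - s'| < d by rewrite -(subrKA x') (le_lt_trans (ler_normD _ _))//; lra.
have b2 : `|l - l'| < d by lra.
have b3 : `|c - c'| < d by lra.
by rewrite -subr_gt0; apply: (dW (s', l', c')).
Qed.

(** One plaque suffices. Its box is a d-neighbourhood of the segment in the directions x_1, y_2 and
    f, unbounded in the others, and [tube] keeps it inside [region]. *)
Lemma same_leaf_plaque z z' : same_leaf z z' -> exists2 c, atlas c & plaque c.1 c.2 z z'.
Proof.
move=> [e H].
pose a := Num.min (z ord0 ix) (z' ord0 ix).
pose b := Num.max (z ord0 ix) (z' ord0 ix).
have ab s : s \in `[a, b] -> btw (z ord0 ix) (z' ord0 ix) s.
  rewrite in_itv/= /btw /a /b.
  by case: (leP (z ord0 ix) (z' ord0 ix)) => _ ->; rewrite ?orbT.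
have [d d0 dH] := @tube a b (z ord0 il) (level z) (fun s sab => H s (ab s sab)).
pose J (j : 'I_(4 + 4)) : interval R :=
  if j == ix then `]a - d, b + d[
  else if j == il then `]z ord0 il - d, z ord0 il + d[
  else if j == iy then `]level z - d, level z + d[
  else `]-oo, +oo[.
have Jx : J ix = `]a - d, b + d[ by [].
have Jl : J il = `]z ord0 il - d, z ord0 il + d[ by [].
have Jy : J iy = `]level z - d, level z + d[ by [].
have inJ w : rsubmx (straighten z) = rsubmx (straighten w) -> a <= w ord0 ix <= b ->
    box J (straighten w).
  move=> ew /andP[aw wb] j; rewrite /J.
  have [->|_] := eqVneq j ix; first by rewrite upd_ix in_itv/=; lra.
  have [->|_] := eqVneq j il; first by rewrite upd_il -(rsub_il ew) in_itv/=; lra.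
  have [->|_] := eqVneq j iy; first by rewrite upd_iy -(rsub_level ew) in_itv/=; lra.
  by rewrite in_itv.
exists (straighten @^-1` box J, straighten).
  split => //=; exists J; split => //.
    by move=> j; rewrite /J; do 3 (case: ifP => _; first exact: interval_open);
      rewrite set_itvE; exact: openT.
  clear e; move=> v Jv; move: (Jv ix) (Jv il) (Jv iy); rewrite Jx Jl Jy !in_itv/=.
  move=> /andP[x1 x2] /andP[l1 l2] /andP[y1 y2].
  have ab' : a <= b by rewrite /a /b ge_min le_max lexx.
  (* The point of [a, b] closest to the x_1-coordinate of v. *)
  pose s := Num.min b (Num.max a (v ord0 ix)).
  have sab : s \in `[a, b] by rewrite in_itv/= le_min ab' le_max lexx /= ge_min lexx.
  apply: (dH _ _ _ _ sab); rewrite ltr_distlC; [|lra|lra].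
  by rewrite /s /Num.min /Num.max; case: (ltP a (v ord0 ix)) => av;
    [case: (ltP b (v ord0 ix)) => vb|case: (ltP b a) => vb]; apply/andP; split; lra.
split => /=; last exact: e.
- by apply: inJ => //; rewrite /a /b ge_min le_max lexx.
- by apply: inJ => //; rewrite /a /b ge_min le_max lexx !orbT.
Qed.

Lemma leafE z : leaf atlas z = same_leaf z.
Proof.
apply/seteqP; split => z'.
- elim => [x y [c Ac /(plaque_same_leaf Ac)]//|x|x y _|x y w _ xy _ yw].
  + exact: same_leaf_refl.
  + exact: same_leaf_sym.
  + exact: same_leaf_trans xy yw.
- by move=> /same_leaf_plaque zz'; apply: rst_step.
Qed.

Definition level_foliation : set (set V) := range (leaf atlas).

Lemma level_foliation_smooth : @smooth_foliation R 4 4 level_foliation.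
Proof.
exists atlas; split => //; split; first exact: atlas_chart.
  by move=> z; have [c Ac [Uz _ _]] := same_leaf_plaque (same_leaf_refl z); exists c.
move=> [U phi] [W psi] /[dup] Ac [/= -> [J [oJ JOm UE]]] [/= -> [J' [oJ' JOm' WE]]] x y.
(* All charts share the map [straighten]: plaques that meet have the same last four coordinates, so
   they intersect in the part of the first one inside W. *)
have [[z [[Ux Uz xz] [Wy Wz yz]]]|no] :=
    pselect (plaque U straighten x `&` plaque W straighten y !=set0).
- exists W; split.
    rewrite WE; apply: open_comp; last exact: open_box.
    by move=> t _; apply: continuous_smooth; apply: smooth_straighten; exact: openT.
  apply/seteqP; split=> [t [? []]//|t [[? Ut xt] Wt]]; split => //.
  by split => //; rewrite yz -xz.
- exists set0; split; first exact: open0.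
  rewrite setI0; apply/eqP/negbNE/negP => /set0P; exact: no.
Qed.

End Foliation.

(** * The leaves *)

Section Sigmoid.
Variable R : realType.
Implicit Types a b c s x y : R.

Definition sigm x := expR x / (1 + expR x).

Lemma sigm_den x : 0 < 1 + expR x.
Proof. by rewrite addr_gt0// expR_gt0. Qed.

Lemma sigm_gt a x : (a < sigm x) = (0 < (1 - a) * expR x - a).
Proof. by rewrite ltr_pdivlMr ?sigm_den//; apply/idP/idP; lra. Qed.

Lemma sigm_lt b x : (sigm x < b) = (0 < b - (1 - b) * expR x).
Proof. by rewrite ltr_pdivrMr ?sigm_den//; apply/idP/idP; lra. Qed.

Lemma sigm_gt0 x : 0 < sigm x.
Proof. by rewrite divr_gt0 ?expR_gt0 ?sigm_den. Qed.

Lemma sigm_lt1 x : sigm x < 1.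
Proof. by rewrite sigm_lt; lra. Qed.

Lemma sigm_mono : {mono sigm : x y / x < y}.
Proof.
move=> x y; rewrite ltr_pdivrMr ?sigm_den// mulrAC ltr_pdivlMr ?sigm_den//.
by rewrite -(ltr_expR x y); apply/idP/idP; lra.
Qed.

Lemma sigm_surj y : 0 < y < 1 -> exists x, sigm x = y.
Proof.
move=> /andP[y0 y1]; exists (ln (y / (1 - y))).
rewrite /sigm lnK ?posrE ?divr_gt0 ?subr_gt0//.
by field; apply/andP; split; lra.
Qed.

(** The component of x0 in the sublevel set is open, hence its image under [sigm] contains neither
    its infimum a nor its supremum b. Working in (0, 1) makes a and b real numbers even for an
    unbounded component. *)
Lemma sigm_component (phi : R -> R) c x0 : continuous phi -> phi x0 < c ->
  exists a b, [/\ 0 <= a, a < b, b <= 1 & forall x,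
    (forall s, btw x0 x s -> phi s < c) <-> a < sigm x < b].
Proof.
move=> phic x0c.
pose I : set R := [set x | forall s, btw x0 x s -> phi s < c].
have Ix0 : I x0.
  by move=> s; rewrite /btw orbb -eq_le => /eqP <-.
have Iopen x : I x -> exists2 d : R, 0 < d & forall y, `|x - y| < d -> I y.
  move=> Ix; have xc : phi x < c by apply: Ix; exact: btwr.
  have /nbhs_ballP[d /= d0 dI] : nbhs x (phi @^-1` [set y | y < c]).
    by apply: phic; apply: open_nbhs_nbhs; split; [exact: open_lt|].
  exists d => // y xy s /(@btw_split _ _ x)/orP[/Ix//|xys].
  apply: dI; rewrite /ball/= ltr_distlC; move: xy; rewrite ltr_distlC => /andP[? ?].
  by move: xys => /orP[]/andP[? ?]; apply/andP; split; lra.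
pose S := sigm @` I.
have S0 : S !=set0 by exists (sigm x0), x0.
have lbS : lbound S 0 by move=> _ [x _ <-]; exact: ltW (sigm_gt0 _).
have ubS : ubound S 1 by move=> _ [x _ <-]; exact: ltW (sigm_lt1 _).
have hiS : has_inf S by split => //; exists 0.
have hsS : has_sup S by split => //; exists 1.
have Sitv x : I x -> inf S < sigm x < sup S.
  move=> Ix; have [d d0 dI] := Iopen x Ix; apply/andP; split.
    apply: (@le_lt_trans _ _ (sigm (x - d / 2))); last by rewrite sigm_mono; lra.
    apply: ge_inf; first by exists 0.
    by exists (x - d / 2) => //; apply: dI; rewrite ltr_distlC; apply/andP; split; lra.
  apply: (@lt_le_trans _ _ (sigm (x + d / 2))); first by rewrite sigm_mono; lra.
  apply: ub_le_sup; first by exists 1.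
  by exists (x + d / 2) => //; apply: dI; rewrite ltr_distlC; apply/andP; split; lra.
exists (inf S), (sup S); split.
- exact: lb_le_inf.
- by have /andP[] := Sitv _ Ix0; apply: lt_trans.
- exact: ge_sup.
- move=> x; split; first exact: Sitv.
  move=> /andP[ax xb].
  have [_ [y1 Iy1 <-] y1x] := inf_lt S0 ax.
  have [_ [y2 Iy2 <-] y2x] := sup_gt S0 xb.
  rewrite !sigm_mono in y1x y2x.
  move=> s /orP[/andP[h1 h2]|/andP[h1 h2]].
    by apply: Iy2; rewrite /btw h1 (le_trans h2 (ltW y2x)).
  by apply: Iy1; rewrite /btw h2 (le_trans (ltW y1x) h1) orbT.
Qed.

End Sigmoid.

(** * A diffeomorphism between the line and a component *)

Section IntervalChart.
Variables (R : realType) (a b : R).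
Hypotheses (a0 : 0 <= a) (ab : a < b) (b1 : b <= 1).
Implicit Types x t : R.

(* [to_itv t] is the x such that sigm x = (a + b e^t) / (1 + e^t): a single formula
   whether the component {x | a < sigm x < b} is bounded or not. *)
Definition to_itv t := ln (a + b * expR t) - ln ((1 - a) + (1 - b) * expR t).
Definition of_itv x := ln ((1 - a) * expR x - a) - ln (b - (1 - b) * expR x).

Lemma to_itv_num t : 0 < a + b * expR t.
Proof.
by apply: ltr_wpDl => //; apply: mulr_gt0 (expR_gt0 t); exact: le_lt_trans ab.
Qed.

Lemma to_itv_den t : 0 < (1 - a) + (1 - b) * expR t.
Proof.
apply: ltr_pwDl; first by rewrite subr_gt0; exact: lt_le_trans b1.
by apply: mulr_ge0 (expR_ge0 t); rewrite subr_ge0.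
Qed.

Lemma expR_to_itv t :
  expR (to_itv t) = (a + b * expR t) / ((1 - a) + (1 - b) * expR t).
Proof. by rewrite expRB !lnK// posrE ?to_itv_num ?to_itv_den. Qed.

(** This and [to_itv_hi] evaluate at [to_itv t] the two arguments of the logarithms in [of_itv].
    Both are positive, which places [to_itv t] in the component, and their quotient is e^t. *)
Lemma to_itv_lo t : (1 - a) * expR (to_itv t) - a
  = (b - a) * expR t / ((1 - a) + (1 - b) * expR t).
Proof. by rewrite expR_to_itv; field; rewrite gt_eqF// to_itv_den. Qed.

Lemma to_itv_hi t : b - (1 - b) * expR (to_itv t)
  = (b - a) / ((1 - a) + (1 - b) * expR t).
Proof. by rewrite expR_to_itv; field; rewrite gt_eqF// to_itv_den. Qed.

Lemma to_itv_in t : a < sigm (to_itv t) < b.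
Proof.
rewrite sigm_gt sigm_lt to_itv_lo to_itv_hi.
by rewrite !divr_gt0 ?mulr_gt0 ?expR_gt0 ?to_itv_den ?subr_gt0.
Qed.

Lemma to_itvK t : of_itv (to_itv t) = t.
Proof.
have D := to_itv_den t; have E := expR_gt0 t.
apply: expR_inj; rewrite /of_itv expRB to_itv_lo to_itv_hi.
rewrite !lnK ?posrE ?divr_gt0 ?mulr_gt0 ?subr_gt0//.
by field; rewrite !gt_eqF ?subr_gt0.
Qed.

Lemma of_itvK x : a < sigm x < b -> to_itv (of_itv x) = x.
Proof.
rewrite sigm_gt sigm_lt => /andP[N M].
have E : expR (of_itv x) = ((1 - a) * expR x - a) / (b - (1 - b) * expR x).
  by rewrite expRB !lnK ?posrE.
have M0 : b - (1 - b) * expR x != 0 by rewrite gt_eqF.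
have ba0 : b - a != 0 by rewrite gt_eqF// subr_gt0.
apply: expR_inj; rewrite expR_to_itv E.
have -> : a + b * (((1 - a) * expR x - a) / (b - (1 - b) * expR x))
  = (b - a) * expR x / (b - (1 - b) * expR x) by field.
have -> : 1 - a + (1 - b) * (((1 - a) * expR x - a) / (b - (1 - b) * expR x))
  = (b - a) / (b - (1 - b) * expR x) by field.
by field; rewrite M0 ba0.
Qed.

Lemma Cinf_to_itv (m : nat) (U : set 'rV[R]_m) f : open U -> Cinf U f ->
  Cinf U (fun v => to_itv (f v)).
Proof.
move=> oU fU.
have eU := Cinf_expR oU fU.
apply: CinfD => //; last apply: CinfN => //; apply: Cinf_ln => //.
- by move=> v _; exact: to_itv_num.
- by apply: CinfD => //; [exact: Cinf_cst|apply: CinfM => //; exact: Cinf_cst].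
- by move=> v _; exact: to_itv_den.
- by apply: CinfD => //; [exact: Cinf_cst|apply: CinfM => //; exact: Cinf_cst].
Qed.

Lemma Cinf_of_itv (m : nat) (U : set 'rV[R]_m) f : open U ->
  (forall v, U v -> a < sigm (f v) < b) -> Cinf U f ->
  Cinf U (fun v => of_itv (f v)).
Proof.
move=> oU fab fU.
have eU := Cinf_expR oU fU.
apply: CinfD => //; last apply: CinfN => //; apply: Cinf_ln => //.
- by move=> v /fab /andP[]; rewrite sigm_gt.
- by apply: CinfD => //; [apply: CinfM => //; exact: Cinf_cst|exact: Cinf_cst].
- by move=> v /fab /andP[_]; rewrite sigm_lt.
- apply: CinfD => //; first exact: Cinf_cst.
  by apply: CinfN => //; apply: CinfM => //; exact: Cinf_cst.
Qed.

End IntervalChart.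

(** * Leaves are Lagrangian copies of R^4 *)

Section Leaf.
Variables (R : realType) (h : R -> R -> R).
Hypothesis h_Cinf : forall (m : nat) (U : set 'rV[R]_m) f g,
  open U -> Cinf U f -> Cinf U g -> Cinf U (fun x => h (f x) (g x)).

Notation V := 'rV[R]_(4 + 4).
Notation lev := (level h).
Notation Psi := (straighten h).
Notation rel := (same_leaf h).

Lemma h_derivable l x : derivable (h^~ l) x 1.
Proof.
by apply: Cinf_derivable; apply: h_Cinf; [exact: openT|exact: Cinf_coord|exact: Cinf_cst].
Qed.

Lemma continuous_h1 l : continuous (h^~ l).
Proof.
by move=> x; apply/differentiable_continuous/derivable1_diffP; exact: h_derivable.
Qed.

Lemma rsubP (v w : V) :
  (forall k : 'I_4, v ord0 (rshift 4 k) = w ord0 (rshift 4 k)) -> rsubmx v = rsubmx w.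
Proof. by move=> H; apply/rowP => k; rewrite !mxE. Qed.

Lemma upd_rshift (z : V) r k : k != ord0 ->
  upd z r ord0 (rshift 4 k) = z ord0 (rshift 4 k).
Proof. by move=> k0; rewrite mxE (inj_eq (@rshift_inj 4 4)) (negPf k0). Qed.

(** The leaf is a graph over (x_1, ..., x_4): there y_1 = ln (c - h(x_1, l)), the other y_i are
    constant, and x_1 runs through one component. Straightening that component by [to_itv]
    parametrizes the leaf by R^4. *)
Lemma leaf_global_chart z0 : exists (f : V -> 'rV[R]_4) (g : 'rV[R]_4 -> V),
  [/\ forall u, rel z0 (g u), cancel g f,
      forall z, rel z0 z -> g (f z) = z,
      smooth setT g & smooth_on (rel z0) f].
Proof.
pose l := z0 ord0 il; pose c := lev z0.
have [a [b [a0 ab b1 H]]] := sigm_component (@continuous_h1 l) (lt_level h z0).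
pose x (u : 'rV[R]_4) := to_itv a b (u ord0 ord0).
pose f (v : V) : 'rV[R]_4 := \row_i
  (if i == ord0 then of_itv a b (v ord0 ix) else v ord0 (lshift 4 i)).
pose g (u : 'rV[R]_4) : V := row_mx
  (\row_i if i == ord0 then x u else u ord0 i)
  (\row_k if k == ord0 then ln (c - h (x u) l) else z0 ord0 (rshift 4 k)).
have gix u : g u ord0 ix = x u by rewrite /g row_mxEl mxE.
have gil u : g u ord0 il = l by rewrite /g row_mxEr mxE.
have giy u : g u ord0 iy = ln (c - h (x u) l) by rewrite /g row_mxEr mxE.
have xab u : a < sigm (x u) < b by exact: to_itv_in.
have xc u : h (x u) l < c by apply: (H (x u)).2 => //; exact: btwr.
have glev u : lev (g u) = c.
  by rewrite /level gix gil giy lnK ?posrE ?subr_gt0// addrC subrK.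
have gL u : rel z0 (g u).
  split; last by rewrite gix; apply: (H (x u)).2.
  apply: rsubP => k; rewrite /straighten; have [->|k0] := eqVneq k ord0.
    by rewrite !upd_iy glev.
  by rewrite !upd_rshift// row_mxEr mxE (negPf k0).
have fg : cancel g f.
  move=> u; apply/rowP => i; rewrite mxE; have [->|i0] := eqVneq i ord0.
    by rewrite gix /x to_itvK.
  by rewrite row_mxEl mxE (negPf i0).
have Lix z : rel z0 z -> a < sigm (z ord0 ix) < b.
  by move=> [_ Hz]; apply: (H _).1.
have gf z : rel z0 z -> g (f z) = z.
  move=> zL; have [e _] := zL.
  have xf : x (f z) = z ord0 ix by rewrite /x mxE eqxx of_itvK//; exact: Lix.
  apply/rowP => j; rewrite -[j]splitK; case: (fintype.split j) => k /=.
    rewrite row_mxEl mxE; have [->|k0] := eqVneq k ord0; first by rewrite xf.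
    by rewrite mxE (negPf k0).
  rewrite row_mxEr mxE; have [->|k0] := eqVneq k ord0.
    rewrite xf /c (rsub_level e) /level /l (rsub_il e).
    by rewrite addrAC subrr add0r expRK.
  by have := rsub_coord k e; rewrite !upd_rshift.
have oT : open [set: 'rV[R]_4] by exact: openT.
have xC : Cinf setT x by apply: Cinf_to_itv => //; exact: Cinf_coord.
exists f, g; split => //.
- apply: smooth_coords => // j; rewrite -[j]splitK; case: (fintype.split j) => k /=.
    under eq_fun do rewrite row_mxEl mxE.
    by case: (k == ord0); [exact: xC|exact: Cinf_coord].
  under eq_fun do rewrite row_mxEr mxE.
  case: (k == ord0); last exact: Cinf_cst.
  apply: Cinf_ln => //; first by move=> u _; rewrite subr_gt0.
  apply: CinfD => //; first exact: Cinf_cst.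
  by apply: CinfN => //; apply: h_Cinf => //; exact: Cinf_cst.
(* f depends on x_1, ..., x_4 only, so its formula is smooth on this open slab around the leaf.
   Openness follows by writing the slab with the arguments of the logarithms in [of_itv]. *)
- pose N : set V := [set v | a < sigm (v ord0 ix) < b].
  have oN : open N.
    pose p1 (v : V) := (1 - a) * expR (v ord0 ix) - a.
    pose p2 (v : V) := b - (1 - b) * expR (v ord0 ix).
    have oV : open [set: V] by exact: openT.
    have eC : Cinf setT (fun v : V => expR (v ord0 ix)).
      by apply: Cinf_expR => //; exact: Cinf_coord.
    have p1c : continuous p1.
      apply: Cinf_continuous; apply: CinfD => //; last exact: Cinf_cst.
      by apply: CinfM => //; exact: Cinf_cst.
    have p2c : continuous p2.
      apply: Cinf_continuous; apply: CinfD => //; first exact: Cinf_cst.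
      by apply: CinfN => //; apply: CinfM => //; exact: Cinf_cst.
    rewrite (_ : N = p1 @^-1` [set y | 0 < y] `&` p2 @^-1` [set y | 0 < y]).
      by apply: openI; apply: open_comp => [v _|];
        [exact: p1c|exact: open_gt|exact: p2c|exact: open_gt].
    apply/seteqP; split => v; rewrite /N/= sigm_gt sigm_lt.
      by move/andP.
    by move=> [? ?]; apply/andP.
  apply: (smooth_smooth_on oN); first by move=> z; exact: Lix.
  apply: smooth_coords => // j; under eq_fun do rewrite mxE.
  case: (j == ord0); last exact: Cinf_coord.
  by apply: Cinf_of_itv => //; exact: Cinf_coord.
Qed.

Lemma leaf_chart z0 :
  diffeomorphic (rel z0) [set: 'rV[R]_4] /\ submanifold 4 (rel z0).
Proof.
have [f [g [gL fg gf gs fs]]] := leaf_global_chart z0.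
have oT : open [set: 'rV[R]_4] by exact: openT.
have gson : smooth_on [set: 'rV[R]_4] g by exact: smooth_smooth_on gs.
split.
  exists f; split; first split.
  - by [].
  - by move=> y z /[!inE] yL zL /(congr1 g); rewrite !gf.
  - by move=> u _; exists (g u).
  split=> //; exists g; split => // z; rewrite inE; exact: gf.
move=> z zL; exists setT, g; split; last by exists (f z) => //; exact: gf.
split=> //; exists setT; split; first exact: openT.
rewrite setIT; split; first split.
- by move=> u _; exact: gL.
- by move=> u v _ _ /(congr1 f); rewrite !fg.
- by move=> y yL; exists (f y) => //; exact: gf.
by split => //; exists f; split => // u _; exact: fg.
Qed.

(** Along the leaf y_1 = p(x_1) and the other y_i are constant. Differentiating these relations
    along any local parametrization gives the same k, the derivative of p. *)
Lemma leaf_tangent z0 z : rel z0 z -> exists k : R,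
  forall v, tangent_space 4 (rel z0) z v ->
  v ord0 iy = k * v ord0 ix /\
  forall i : 'I_4, i != ord0 -> v ord0 (rshift 4 i) = 0.
Proof.
move=> zL.
pose l := z0 ord0 il; pose c := lev z0.
pose p (t : R) := ln (c - h t l).
have zc : h (z ord0 ix) l < c by apply: zL.2; exact: btwr.
have pd : derivable p (z ord0 ix) 1.
  have d1 : derivable (fun t => c - h t l) (z ord0 ix) 1.
    apply: derivableB; first exact: derivable_cst.
    exact: h_derivable.
  apply: (@ex_derive _ _ _ _ _ _ _ (is_derive1_comp _ (derivableP d1))).
  by apply: is_derive1_ln; rewrite subr_gt0.
exists ('D_1 p (z ord0 ix)) => v [U [g [u [w [[oU [W [oW [gb _]]]] Uu gu <-]]]]].
subst z.
(* A derivative that does not exist is 0 by convention, and the zero vector satisfies both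
   relations. *)
have [gd|/derive_nderivable ->] := pselect (derivable g u w); last first.
  by split=> [|i _]; rewrite !mxE ?mulr0.
have gdj j : derivable (fun t => g t ord0 j) u w by exact: (derivable_mxP _ _ _).1.
have gL t : U t -> rel z0 (g t).
  by case: gb => gf _ _ /gf [].
have nE e1 e2 : (forall y, rel z0 y -> e1 y = e2 y :> R) ->
    \near u, e1 (g u) = e2 (g u).
  by move=> e12; apply: near_eq_open oU _ Uu => t /[1!inE] /gL; exact: e12.
rewrite (derive_mx gd); split=> [|i i0]; rewrite !mxE.
  rewrite -(@derive_val _ _ _ _ _ _ _ (is_derive_comp (derivableP pd) (gdj ix))).
  apply: near_eq_derive; apply: (nE (fun y => y ord0 iy) (fun y => p (y ord0 ix))).
  move=> y [e _]; rewrite /p /c (rsub_level e) /level /l (rsub_il e).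
  by rewrite addrAC subrr add0r expRK.
rewrite -[RHS](derive_cst (z0 ord0 (rshift 4 i)) u w).
apply: near_eq_derive; apply: (nE (fun y => y ord0 (rshift 4 i)) (fun=> z0 ord0 (rshift 4 i))).
by move=> y [e _]; have := rsub_coord i e; rewrite !upd_rshift.
Qed.

Lemma leaf_lagrangian z0 : @lagrangian R 4 (rel z0).
Proof.
split; first exact: (leaf_chart z0).2.
move=> z v w zL; have [k tk] := leaf_tangent zL.
(* Only the pair (x_1, y_1) contributes to omega, and the restrictions of v and w to it are both
   proportional to (1, k). *)
move=> /tk[v0 vi] /tk[w0 wi]; rewrite /omega (bigD1 ord0)//= big1 ?addr0.
  move: v0 w0; rewrite /ix /iy => -> ->; ring.
by move=> i i0; rewrite vi// wi// mulr0 mul0r subrr.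
Qed.

End Leaf.

(** * Non-separated leaves *)

Section Invariant.

(* A leaf is non-separated from itself, so it is counted in its [nonsep_class]. *)
Definition nonsep (T : topologicalType) (F : set (set T)) (L L' : set T) :=
  forall x x' U U', L x -> L' x' -> open U -> U x -> open U' -> U' x' ->
  exists M, [/\ F M, M `&` U !=set0 & M `&` U' !=set0].

Definition nonsep_class (T : topologicalType) (F : set (set T)) (L : set T) :=
  [set L' | F L' /\ nonsep F L L'].

Definition spectrum (T : topologicalType) (F : set (set T)) : set nat :=
  [set k | exists L, F L /\ (nonsep_class F L #= `I_k)%card].

Lemma nonsep_sym (T : topologicalType) (F : set (set T)) L L' :
  nonsep F L L' -> nonsep F L' L.
Proof.
by move=> H x x' U U' Lx Lx' oU Ux oU' Ux'; have [M []] := H _ _ _ _ Lx' Lx oU' Ux' oU Ux;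
  exists M.
Qed.

Lemma nonsep_homeo (T T' : topologicalType) (f : T -> T') (F : set (set T)) L L' :
  continuous f -> nonsep F L L' ->
  nonsep [set f @` L | L in F] (f @` L) (f @` L').
Proof.
move=> fc FLL' _ _ U U' [x Lx <-] [x' Lx' <-] oU Ux oU' Ux'.
have oP W : open W -> open (f @^-1` W) by move=> oW; apply: open_comp.
have [M [FM [a [Ma Ua]] [b [Mb Ub]]]] :=
  FLL' x x' _ _ Lx Lx' (oP _ oU) Ux (oP _ oU') Ux'.
exists (f @` M); split; first by exists M.
- by exists (f a); split => //; exists a.
- by exists (f b); split => //; exists b.
Qed.

(** Non-separation is phrased with leaves and open sets only, so f carries classes to classes; g
    gives the converse inclusion and the bijectivity on leaves. *)
Lemma spectrum_homeo (T T' : topologicalType) (f : T -> T') (g : T' -> T)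
    (F : set (set T)) :
  continuous f -> continuous g -> cancel f g -> cancel g f ->
  spectrum F `<=` spectrum [set f @` L | L in F].
Proof.
move=> fc gc fg gf k [L [FL Lk]].
have gfI A : g @` (f @` A) = A.
  by rewrite image_comp (_ : g \o f = id) ?image_id//; apply/funext.
exists (f @` L); split; first by exists L.
have fgI A : f @` (g @` A) = A.
  by rewrite image_comp (_ : f \o g = id) ?image_id//; apply/funext.
have gF : [set g @` M | M in [set f @` L | L in F]] = F.
  apply/seteqP; split=> [_ [_ [M FM <-] <-]|M FM]; first by rewrite gfI.
  by exists (f @` M); [exists M|exact: gfI].
have -> : nonsep_class [set f @` L | L in F] (f @` L) = [set f @` M | M in nonsep_class F L].
  apply/seteqP; split=> [_ [[M FM <-] LM]|_ [M [FM LM] <-]]; last first.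
    by split; [exists M|exact: nonsep_homeo].
  exists M => //; split => //.
  by have := nonsep_homeo gc LM; rewrite gF !gfI.
apply: card_eq_trans Lk; apply: inj_card_eq => A B _ _ /(congr1 (image ^~ g)).
by rewrite !gfI.
Qed.

Lemma spectrum_equivalent (R : realType) (n : nat) (F G : set (set 'rV[R]_n)) :
  smoothly_equivalent F G -> spectrum F = spectrum G.
Proof.
move=> [f [[[_ finj fsurj] [fs [g [fg gs]]]] <-]].
have fK : cancel f g by move=> x; apply: fg; rewrite inE.
have gK : cancel g f by move=> y; have [x _ <-] := fsurj y I; rewrite fK.
have fc := smooth_on_continuous fs; have gc := smooth_on_continuous gs.
apply/seteqP; split; first exact: (spectrum_homeo fc gc).
rewrite -[in X in _ `<=` X](_ : [set g @` M | M in [set f @` L | L in F]] = F).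
  exact: (spectrum_homeo gc fc).
have gfI A : g @` (f @` A) = A.
  by rewrite image_comp (_ : g \o f = id) ?image_id//; apply/funext.
apply/seteqP; split=> [_ [_ [M FM <-] <-]|M FM]; first by rewrite gfI.
by exists (f @` M); [exists M|exact: gfI].
Qed.

End Invariant.

(** * Non-separation for the level foliations *)

Section NonSeparated.
Variables (R : realType) (h : R -> R -> R).
Hypothesis h_Cinf : forall (m : nat) (U : set 'rV[R]_m) f g,
  open U -> Cinf U f -> Cinf U g -> Cinf U (fun x => h (f x) (g x)).

Notation V := 'rV[R]_(4 + 4).
Notation lev := (level h).
Notation Psi := (straighten h).
Notation rel := (same_leaf h).
Notation fol := (level_foliation h).

Lemma folP L : fol L <-> exists z, L = rel z.
Proof.
split=> [[z _ <-]|[z ->]]; first by exists z; rewrite leafE.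
by exists z => //; rewrite leafE.
Qed.

Lemma same_leafP z z' : rel z = rel z' <-> rel z z'.
Proof.
split=> [->|zz']; first exact: same_leaf_refl.
apply/seteqP; split => y; last exact: same_leaf_trans.
by apply: same_leaf_trans; exact: same_leaf_sym.
Qed.

(** The weak inequality replaces the strict one of [same_leaf]. By [nonsep_classE] this describes
    non-separation, which is therefore an equivalence relation on these leaves. *)
Definition touching (z z' : V) : Prop :=
  rsubmx (Psi z) = rsubmx (Psi z') /\
  forall s, btw (z ord0 ix) (z' ord0 ix) s -> h s (z ord0 il) <= lev z.

(* Raising the level by e > 0 merges the leaves that touch. *)
Definition raise (z : V) (e : R) : V := upd z (ln (expR (z ord0 iy) + e)).

Lemma raise0 z : raise z 0 = z.
Proof. by rewrite /raise addr0 expRK upd_id. Qed.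

Lemma level_raise z e : 0 <= e -> lev (raise z e) = lev z + e.
Proof.
move=> e0; rewrite /level upd_ix upd_il upd_iy lnK ?addrA//.
by rewrite posrE ltr_pwDl ?expR_gt0.
Qed.

Lemma raise_continuous z : {for 0, continuous (raise z)}.
Proof.
apply: continuous_rV => j; have [->|jy] := eqVneq j iy; last first.
  have -> : (fun e => raise z e ord0 j) = fun=> z ord0 j.
    by apply/funext => e; rewrite mxE (negPf jy).
  exact: cst_continuous.
have -> : (fun e => raise z e ord0 iy) = (@ln R) \o (fun e => expR (z ord0 iy) + e).
  by apply/funext => e; rewrite upd_iy.
apply: continuous_comp; last by apply: continuous_ln; rewrite addr0 expR_gt0.
by apply: cvgD; [exact: cvg_cst|exact: cvg_id].
Qed.

(** Raise points x and x' of the two leaves by the same small d > 0. The new level exceeds h on the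
    whole stretch between them, so the raised points share a leaf, and it meets both
    neighbourhoods. *)
Lemma touching_nonsep z z' : touching z z' -> nonsep fol (rel z) (rel z').
Proof.
move=> [e H] x x' U U' [ex Hx] [ex' Hx'] oU Ux oU' Ux'.
have near_raise y W : open W -> W y -> \forall d \near (0 : R)^'+, W (raise y d).
  move=> oW Wy; apply: cvg_within; apply: (@raise_continuous y).
  by apply: open_nbhs_nbhs; split => //; rewrite raise0.
have : \forall d \near (0 : R)^'+, [/\ 0 < d, U (raise x d) & U' (raise x' d)].
  near=> d; split; near: d; [exact: nbhs_right_gt|exact: near_raise..].
move=> /filter_ex[d [d0 Ud U'd]].
have lx : lev x = lev z by rewrite (rsub_level ex).
have lx' : lev x' = lev z by rewrite (rsub_level e) (rsub_level ex').
have rx : rsubmx (Psi x) = rsubmx (Psi x') by rewrite -ex -ex'.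
exists (rel (raise x d)); split.
- by apply/folP; exists (raise x d).
- by exists (raise x d); split => //; exact: same_leaf_refl.
exists (raise x' d); split => //; split.
  apply: rsubP => k; have [->|k0] := eqVneq k ord0.
    by rewrite !upd_iy !level_raise ?ltW// lx lx'.
  by have := rsub_coord k rx; rewrite !upd_rshift.
move=> s; rewrite !upd_ix upd_il level_raise ?(ltW d0)// -(rsub_il ex) lx => bs.
suff : h s (z ord0 il) <= lev z by lra.
(* The way from x to x' is covered by three stretches: inside the first leaf, across the gap from z
   to z', and inside the second leaf. *)
have /orP[b1|/(@btw_split _ _ (z' ord0 ix))/orP[|b1]] :=
  @btw_split _ _ (z ord0 ix) _ _ bs.
- by apply/ltW/Hx; rewrite btwC.
- exact: H.
- by rewrite (rsub_level e) (rsub_il e); exact/ltW/Hx'.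
Unshelve. all: by end_near. Qed.

(** If the values of q differ, the open sets where q lies below and above their midpoint m separate
    the leaves. *)
Lemma nonsep_const z z' (q : V -> R) :
  continuous q -> (forall x y, rel x y -> q x = q y) ->
  nonsep fol (rel z) (rel z') -> q z = q z'.
Proof.
move=> qc qL zz'; apply: contrapT => /eqP; rewrite neq_lt => qq.
have oP m : open (q @^-1` [set r | r < m]) by
  apply: open_comp; [move=> ? _; exact: qc|exact: open_lt].
have oQ m : open (q @^-1` [set r | m < r]) by
  apply: open_comp; [move=> ? _; exact: qc|exact: open_gt].
pose m := (q z + q z') / 2.
have zz := @same_leaf_refl R h z; have z'z' := @same_leaf_refl R h z'.
have no M a b : fol M -> M a -> M b -> q a = q b.
  by move=> /folP[y ->] /qL <- /qL <-.
case/orP : qq => qq.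
  have h1 : q z < m by rewrite /m; lra.
  have h2 : m < q z' by rewrite /m; lra.
  have [M [FM [a [Ma am]] [b [Mb bm]]]] := zz' _ _ _ _ zz z'z' (oP m) h1 (oQ m) h2.
  by move: am bm; rewrite /= (no _ _ _ FM Ma Mb) => /lt_trans/[apply]; rewrite ltxx.
have h1 : q z' < m by rewrite /m; lra.
have h2 : m < q z by rewrite /m; lra.
have [M [FM [a [Ma am]] [b [Mb bm]]]] := zz' _ _ _ _ zz z'z' (oQ m) h2 (oP m) h1.
by move: am bm; rewrite /= (no _ _ _ FM Ma Mb) => /lt_trans/[apply]; rewrite ltxx.
Qed.

(** If h(s, l) exceeded the level of z, points near z would have x_1 < s and level below h(s, y_2),
    and points near z' would have x_1 > s. No leaf can cross s from the former to the latter. *)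
Lemma nonsep_le z z' s : nonsep fol (rel z) (rel z') ->
  z ord0 ix < s < z' ord0 ix -> h s (z ord0 il) <= lev z.
Proof.
move=> zz' /andP[zs sz']; rewrite leNgt; apply/negP => hs.
have oT : open [set: V] by exact: openT.
pose q (v : V) := h s (v ord0 il) - lev v.
have qc : continuous q.
  apply: Cinf_continuous; apply: CinfD => //.
    by apply: h_Cinf => //; [exact: Cinf_cst|exact: Cinf_coord].
  by apply: CinfN => //; exact: Cinf_level.
have xc : continuous (fun v : V => v ord0 ix) by exact: coord_continuous.
pose U := q @^-1` [set r | 0 < r] `&` (fun v : V => v ord0 ix) @^-1` [set r | r < s].
pose U' := (fun v : V => v ord0 ix) @^-1` [set r | s < r].
have oU : open U by apply: openI;
  apply: open_comp; [move=> ? _; exact: qc|exact: open_gt|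
  move=> ? _; exact: xc|exact: open_lt].
have oU' : open U' by apply: open_comp; [move=> ? _; exact: xc|exact: open_gt].
have Uz : U z by split => //; rewrite /q/= subr_gt0.
have [M [/folP[y ->] [v [yv [qv vs]]] [v' [yv' sv']]]] :=
  zz' _ _ _ _ (same_leaf_refl h z) (same_leaf_refl h z') oU Uz oU' sz'.
have [_ /(_ s)] := same_leaf_trans (same_leaf_sym yv) yv'.
rewrite /btw (ltW vs) (ltW sv') => /(_ isT).
by move: qv; rewrite /q/= subr_gt0 => /lt_trans + h1 => /(_ _ h1); rewrite ltxx.
Qed.

Lemma nonsep_touching z z' : nonsep fol (rel z) (rel z') -> touching z z'.
Proof.
move=> zz'.
have e : rsubmx (Psi z) = rsubmx (Psi z').
  apply: rsubP => k; apply: (nonsep_const (q := fun v => Psi v ord0 (rshift 4 k))) zz'.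
    have oT : open [set: V] by exact: openT.
    by apply: Cinf_continuous; apply: Cinf_upd => //; exact: Cinf_level.
  by move=> x y [exy _]; exact: rsub_coord.
split => // s.
have zl := ltW (lt_level h z).
have zl' := ltW (lt_level h z').
rewrite -(rsub_il e) -(rsub_level e) in zl'.
move=> /orP[]/andP[]; rewrite (le_eqVlt _ s) (le_eqVlt s).
  move=> /orP[/eqP <- //|s1] /orP[/eqP -> //|s2].
  by apply: (nonsep_le zz'); rewrite s1 s2.
move=> /orP[/eqP <- //|s1] /orP[/eqP -> //|s2].
rewrite (rsub_il e) (rsub_level e).
by apply: (nonsep_le (nonsep_sym zz')); rewrite s1 s2.
Qed.

Lemma nonsep_classE z : nonsep_class fol (rel z) = [set rel z' | z' in touching z].
Proof.
apply/seteqP; split=> [L [/folP[z' ->] /nonsep_touching zz']|_ [z' zz' <-]].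
  by exists z'.
by split; [apply/folP; exists z'|exact: touching_nonsep].
Qed.

End NonSeparated.

(** * The profile and its spectrum *)

Section Trigo.
Variable R : realType.
Implicit Types w t x : R.

(** Subtracting the largest multiple of pi below x leaves a remainder in [0, pi), where the sine
    vanishes only at 0. *)
Lemma sin_eq0_nat x : 0 <= x -> sin x = 0 -> exists n : nat, x = n%:R * pi.
Proof.
move=> x0 sx; have p0 := pi_gt0 R.
have q0 : 0 <= x / pi by rewrite divr_ge0// ltW.
pose n := Num.truncn (x / pi); exists n.
have /andP[n1 n2] : n%:R <= x / pi < n.+1%:R by exact: truncn_itv.
rewrite ler_pdivlMr// in n1; rewrite ltr_pdivrMr// in n2.
pose r := x - n%:R * pi.
have sr : sin r = 0.
  have : sin (r + pi *+ n) = (-1) ^+ n * sin r by exact: (alternatingn (@sinDpi R)).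
  rewrite (_ : r + pi *+ n = x); last by rewrite /r -(mulr_natl pi n) subrK.
  by rewrite sx => /esym/eqP; rewrite mulf_eq0 signr_eq0 /= => /eqP.
apply/eqP; rewrite -subr_eq0 -/r; apply/negPn/negP => rN0.
suff : 0 < sin r by rewrite sr ltxx.
apply: sin_gt0_pi; rewrite lt_neqAle eq_sym rN0 /r.
by move: n2; rewrite -natr1; lra.
Qed.

Lemma cos_eq1_nat x : 0 <= x -> cos x = 1 -> exists n : nat, x = n%:R * (2 * pi).
Proof.
move=> x0 cx.
(* By the identity 1 - cos x = 2 sin(x/2)^2. *)
have : sin (x / 2) = 0.
  have := cosD (x / 2) (x / 2); rewrite -splitr cx => E.
  have F := cos2Dsin2 (x / 2).
  by apply/eqP; rewrite -sqrf_eq0 expr2; apply/eqP; lra.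
move=> /(sin_eq0_nat (divr_ge0 x0 _))[//|n xn]; exists n; lra.
Qed.

Lemma cos_lt1 (n : nat) x : n%:R * (2 * pi) < x < n.+1%:R * (2 * pi) -> cos x < 1.
Proof.
move=> /andP[nx xn]; rewrite lt_neqAle cos_le1 andbT; apply/eqP => c1.
have p0 := pi_gt0 R; have pp : 0 < 2 * pi :> R by lra.
have x0 : 0 <= x by apply: le_trans (ltW nx); apply: mulr_ge0; [exact: ler0n|exact: ltW].
have [k xk] := cos_eq1_nat x0 c1.
move: nx xn; rewrite xk !ltr_pM2r// !ltr_nat ltnS => h1 h2.
by rewrite leqNgt h1 in h2.
Qed.

Lemma cos_nat (n : nat) : cos (n%:R * (2 * pi)) = 1 :> R.
Proof.
rewrite (_ : n%:R * _ = 0 + pi *+ 2 *+ n); last first.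
  by rewrite add0r -(mulr_natl (pi *+ 2) n) -(mulr_natl pi 2).
by rewrite (periodicn (@cosD2pi R)) cos0.
Qed.

Definition tilt w t := w * t + cos t.

(** The first-order condition gives w = sin p. The sign of cos p comes from a symmetric second
    difference at p - d, p, p + d. *)
Lemma tilt_local_max w a b p : a < p < b ->
  (forall t, a < t < b -> tilt w t <= tilt w p) -> w = sin p /\ 0 <= cos p.
Proof.
move=> pab H.
have dt t : is_derive t 1 (tilt w) (w - sin t).
  have H0 : is_derive t 1 (w *: id + (@cos R)) (w *: 1 + - sin t) by apply: is_deriveD.
  by apply: (is_derive_eq H0); rewrite /GRing.scale/= mulr1.
have dmax : is_derive p 1 (tilt w) 0.
  apply: (@derive1_at_max _ (tilt w) a b).
  - by move: pab => /andP[] /lt_trans/[apply]/ltW.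
  - by move=> t _; exact: (@ex_derive _ _ _ _ _ _ _ (dt t)).
  - by rewrite in_itv.
  - by move=> t; rewrite in_itv; exact: H.
have ws : w = sin p.
  by apply/eqP; rewrite -subr_eq0 -(@derive_val _ _ _ _ _ _ _ (dt p))
    (@derive_val _ _ _ _ _ _ _ dmax).
split => //; rewrite leNgt; apply/negP => cp.
move: pab => /andP[ap pb].
(* Small enough for p - d and p + d to stay in (a, b), and less than 2 pi, so that cos d < 1. *)
pose d := Num.min 1 (Num.min ((p - a) / 2) ((b - p) / 2)).
have d0 : 0 < d by rewrite !lt_min; lra.
have d1 : d <= 1 by rewrite ge_min lexx.
have da : d <= (p - a) / 2 by rewrite !ge_min lexx orbT.
have db : d <= (b - p) / 2 by rewrite !ge_min lexx !orbT.
have cd : cos d < 1.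
  apply: (@cos_lt1 0); rewrite mul0r d0 mul1r.
  by have := pi_ge2 R; lra.
(* Adding the two inequalities eliminates w and leaves (1 - cos d) cos p >= 0. *)
have h1 : tilt w (p + d) <= tilt w p by apply: H; lra.
have h2 : tilt w (p - d) <= tilt w p by apply: H; lra.
move: h1 h2; rewrite /tilt cosB cosD.
have : 0 < (1 - cos d) * - cos p by rewrite mulr_gt0; lra.
lra.
Qed.

(** Both maxima have sine w and nonnegative cosine, hence equal cosines. Equal heights then leave w
    (p2 - p1) = 0, and for w = 0 the nonnegative cosine must be 1. *)
Lemma tilt_two_max w a b p1 p2 c : a < p1 -> p1 < p2 -> p2 < b ->
  (forall t, a < t < b -> tilt w t <= c) -> tilt w p1 = c -> tilt w p2 = c ->
  w = 0 /\ c = 1.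
Proof.
move=> ap1 p12 p2b H c1 c2.
have [w1 k1] : w = sin p1 /\ 0 <= cos p1.
  by apply: (@tilt_local_max w a b); rewrite ?c1//; lra.
have [w2 k2] : w = sin p2 /\ 0 <= cos p2.
  by apply: (@tilt_local_max w a b); rewrite ?c2//; lra.
have kk : cos p1 = cos p2.
  apply/eqP; rewrite -(eqrXn2 (n := 2)) //.
  by rewrite !cos2sin2 -w1 -w2.
have w0 : w = 0.
  have : w * (p2 - p1) = 0 by move: c1 c2; rewrite /tilt; lra.
  by move/eqP; rewrite mulf_eq0 subr_eq0 (gt_eqF p12) orbF => /eqP.
split => //; rewrite -c1 /tilt w0 mul0r add0r.
have := cos2sin2 p1; rewrite -w1 w0 expr0n /= subr0 => /eqP.
rewrite sqrf_eq1 => /orP[/eqP//|/eqP E]; lra.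
Qed.

End Trigo.

Lemma natceilP (R : realType) (t : R) : 0 < t -> exists N : nat, N%:R - 1 < t <= N%:R.
Proof.
move=> t0; have /andP[n1 n2] := truncn_itv (ltW t0).
have [nt|nt] := eqVneq (Num.truncn t)%:R t.
  by exists (Num.truncn t); rewrite nt; lra.
exists (Num.truncn t).+1; rewrite -natr1 in n2 *.
have : (Num.truncn t)%:R < t by rewrite lt_neqAle nt.
lra.
Qed.

(** * Leaves on a common level set *)

Section Clusters.
Variables (R : realType) (h : R -> R -> R).
Notation V := 'rV[R]_(4 + 4).
Implicit Types x y z : V.

Lemma touching_sym x y : touching h x y -> touching h y x.
Proof.
by move=> [e H]; split=> // s; rewrite btwC => /H; rewrite (rsub_il e) (rsub_level e).
Qed.

Lemma touching_trans y x z : touching h x y -> touching h y z -> touching h x z.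
Proof.
move=> [e H] [e' H']; split; first by rewrite e.
move=> s /(@btw_split _ _ (y ord0 ix))/orP[/H//|/H'].
by rewrite (rsub_il e) (rsub_level e).
Qed.

(** Distinct touching leaves are kept apart by a point where h attains the level; at the two
    endpoints the inequality is strict by [lt_level]. *)
Lemma touching_contact x y :
  x ord0 ix <= y ord0 ix -> touching h x y -> ~ same_leaf h x y ->
  exists2 s, x ord0 ix < s < y ord0 ix & h s (x ord0 il) = level h x.
Proof.
move=> xy [e H] nxy; apply: contrapT => nex; apply: nxy; split => // s bs.
rewrite lt_neqAle H// andbT; apply/eqP => hs; apply: nex; exists s => //.
have sx : s != x ord0 ix.
  by apply: contraTneq (lt_level h x) => <-; rewrite hs ltxx.
have sy : s != y ord0 ix.
  apply: contraTneq (lt_level h y) => <-.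
  by rewrite -(rsub_il e) -(rsub_level e) hs ltxx.
move: bs; rewrite /btw => /orP[/andP[h1 h2]|/andP[h1 h2]].
  by rewrite !lt_neqAle h1 h2 eq_sym sx sy.
have E : s = x ord0 ix by apply/eqP; rewrite eq_le h2 (le_trans xy h1).
by rewrite E eqxx in sx.
Qed.

End Clusters.

(** * The profile with parameter al *)

Section Profile.
Variables (R : realType) (al : R).
Hypothesis al3 : 3 <= al.

Definition slope (l : R) : R := sin (expR l / (2 * al)).
Definition profile (x l : R) : R := tilt (slope l) (expR l * sigm x).

Lemma profile_Cinf (m : nat) (U : set 'rV[R]_m) f g :
  open U -> Cinf U f -> Cinf U g -> Cinf U (fun v => profile (f v) (g v)).
Proof.
move=> oU fU gU.
have eU := Cinf_expR oU gU.
have dU : Cinf U (fun v => 1 + expR (f v)).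
  by apply: CinfD => //; [exact: Cinf_cst|exact: Cinf_expR].
have sU : Cinf U (fun v => sigm (f v)).
  (* The reciprocal is written as exp(-ln), which reduces it to closure under exponential and
     logarithm. *)
  have -> : (fun v => sigm (f v)) =
      (fun v => expR (f v) * expR (- ln (1 + expR (f v)))).
    by apply/funext => v; rewrite expRN lnK// posrE sigm_den.
  apply: CinfM => //; first exact: Cinf_expR.
  apply: Cinf_expR => //; apply: CinfN => //; apply: Cinf_ln => //.
have tU : Cinf U (fun v => expR (g v) * sigm (f v)) by exact: CinfM.
apply: CinfD => //; last exact: (Cinf_cos_sin oU tU).1.
apply: CinfM => //.
have aU : Cinf U (fun v => expR (g v) / (2 * al)).
  by apply: CinfM => //; exact: Cinf_cst.
exact: (Cinf_cos_sin oU aU).2.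
Qed.

Notation V := 'rV[R]_(4 + 4).
Notation lev := (level profile).
Notation rel := (same_leaf profile).
Notation touch := (touching profile).
Notation pfol := (level_foliation profile).
Implicit Types x y z : V.

Lemma pfolP L : pfol L <-> exists z, L = rel z.
Proof. exact: (folP (@profile_Cinf)). Qed.

(** The contact points between consecutive leaves are two maxima of h(., l) of the same height over
    the range from x to z. In the variable t = E sigm(s) this is the situation of [tilt_two_max]. *)
Lemma three_leaves_sorted x y z :
  x ord0 ix <= y ord0 ix -> y ord0 ix <= z ord0 ix ->
  touch x y -> touch y z -> ~ rel x y -> ~ rel y z ->
  slope (x ord0 il) = 0 /\ lev x = 1.
Proof.
move=> xy yz nxy nyz rxy ryz.
have [s1 /andP[xs1 s1y] hs1] := touching_contact xy nxy rxy.
have [s2 /andP[ys2 s2z] hs2] := touching_contact yz nyz ryz.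
rewrite -(rsub_il nxy.1) -(rsub_level nxy.1) in hs2.
have [_ H] := touching_trans nxy nyz.
pose E := expR (x ord0 il); have E0 : 0 < E by exact: expR_gt0.
have mono a b : (E * sigm a < E * sigm b) = (a < b).
  by rewrite ltr_pM2l// sigm_mono.
apply: (@tilt_two_max _ _ (E * sigm (x ord0 ix)) (E * sigm (z ord0 ix))
  (E * sigm s1) (E * sigm s2)) => //; rewrite ?mono//.
  exact: lt_trans ys2.
move=> t /andP[xt tz].
have [u ut] : exists u, sigm u = t / E.
  apply: sigm_surj; rewrite divr_gt0//=; last first.
    by apply: lt_trans xt; rewrite mulr_gt0 ?sigm_gt0.
  rewrite ltr_pdivrMr// mul1r; apply: lt_trans tz _.
  by rewrite gtr_pMr// sigm_lt1.
have tE : t = E * sigm u by rewrite ut mulrC divfK// gt_eqF.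
move: xt tz; rewrite tE !mono => xu uz.
by apply: H; rewrite /btw (ltW xu) (ltW uz).
Qed.

(** The conclusion depends only on y_2 and the level, which touching points share ([tr]), so the
    three points may be permuted to sort their x_1-coordinates. *)
Lemma three_leaves x y z : touch x y -> touch y z ->
  ~ rel x y -> ~ rel y z -> ~ rel x z -> slope (x ord0 il) = 0 /\ lev x = 1.
Proof.
move=> nxy nyz rxy ryz rxz.
have nxz := touching_trans nxy nyz.
have ns a b : ~ rel a b -> ~ rel b a by move=> nab /same_leaf_sym.
have nyx := touching_sym nxy; have nzy := touching_sym nyz; have nzx := touching_sym nxz.
have S a b c := @three_leaves_sorted a b c.
have tr a : touch x a -> slope (a ord0 il) = 0 /\ lev a = 1 ->
    slope (x ord0 il) = 0 /\ lev x = 1.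
  by move=> [e _]; rewrite (rsub_il e) (rsub_level e).
have [xy|yx] := leP (x ord0 ix) (y ord0 ix);
  have [yz|zy] := leP (y ord0 ix) (z ord0 ix);
  have [xz|zx] := leP (x ord0 ix) (z ord0 ix).
- exact: (S x y z).
- exact: (S x y z).
- by apply: (S x z y) => //; [exact: ltW|exact: ns].
- by apply: (tr z) => //; apply: (S z x y) => //; [exact: ltW|exact: ns].
- by apply: (tr y) => //; apply: (S y x z) => //; [exact: ltW|exact: ns].
- by apply: (tr y) => //; apply: (S y z x) => //; [exact: ltW|exact: ns].
- by apply: (tr z) => //; apply: (S z y x) => //; [exact: ltW|exact: ltW|exact: ns|exact: ns].
- by apply: (tr z) => //; apply: (S z y x) => //; [exact: ltW|exact: ltW|exact: ns|exact: ns].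
Qed.

(** Here h(s, l) = cos(E sigm(s)) reaches the level 1 exactly where E sigm(s) is a multiple of 2 pi.
    The leaves correspond to the intervals from 2 pi n to 2 pi (n+1), cut off at E; the bounds on E
    leave n = 0, ..., N - 1. *)
Lemma nonsep_class_card z (N : nat) : slope (z ord0 il) = 0 -> lev z = 1 ->
  (N%:R - 1) * (2 * pi) < expR (z ord0 il) <= N%:R * (2 * pi) ->
  (nonsep_class pfol (rel z) #= `I_N)%card.
Proof.
move=> w0 z1 /andP[NE EN].
pose E := expR (z ord0 il); have E0 : 0 < E by exact: expR_gt0.
have p0 := pi_gt0 R; have pp : 0 < 2 * pi :> R by lra.
have hcos s : profile s (z ord0 il) = cos (E * sigm s).
  by rewrite /profile /tilt w0 mul0r add0r.
have surj t : 0 < t < E -> exists s, E * sigm s = t.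
  move=> /andP[t0 tE]; have [|s st] := @sigm_surj _ (t / E).
    by rewrite divr_gt0//= ltr_pdivrMr// mul1r.
  by exists s; rewrite st mulrC divfK// gt_eqF.
have smono a b : (E * sigm a < E * sigm b) = (a < b) by rewrite ltr_pM2l// sigm_mono.
have /choice[y yP] (n : nat) : exists y : V, (n < N)%N ->
    [/\ lev y = 1, y ord0 il = z ord0 il,
        rsubmx (straighten profile z) = rsubmx (straighten profile y) &
        n%:R * (2 * pi) < E * sigm (y ord0 ix) < n.+1%:R * (2 * pi)].
  have [nN|] := boolP (n < N)%N; last by exists z.
  have nE : n%:R * (2 * pi) < E.
    apply: le_lt_trans NE; rewrite ler_pM2r; last lra.
    by rewrite lerBrDr natr1 ler_nat.
  (* The last interval may be cut off by E; t is the midpoint of what remains. *)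
  pose m := Num.min E (n.+1%:R * (2 * pi)).
  have nm : n%:R * (2 * pi) < m.
    have hn : n%:R * (2 * pi) < n.+1%:R * (2 * pi) :> R.
      by rewrite ltr_pM2r// ltr_nat.
    by rewrite lt_min nE hn.
  have mE : m <= E by rewrite ge_min lexx.
  have mn : m <= n.+1%:R * (2 * pi) by rewrite ge_min lexx orbT.
  have n0 : 0 <= n%:R * (2 * pi) :> R by apply: mulr_ge0; [exact: ler0n|lra].
  pose t := (n%:R * (2 * pi) + m) / 2.
  have [s st] : exists s, E * sigm s = t by apply: surj; rewrite /t; lra.
  have tn : n%:R * (2 * pi) < t < n.+1%:R * (2 * pi) by rewrite /t; lra.
  have ct := cos_lt1 tn.
  (* This y_1 brings the level to cos t + (1 - cos t) = 1. *)
  pose y : V := \row_j (if j == ix then s else upd z (ln (1 - cos t)) ord0 j).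
  have yx : y ord0 ix = s by rewrite mxE eqxx.
  have yl : y ord0 il = z ord0 il by rewrite mxE /= upd_il.
  have yy : y ord0 iy = ln (1 - cos t) by rewrite mxE /= upd_iy.
  have ly : lev y = 1.
    by rewrite /level yx yl yy hcos st lnK ?posrE ?subr_gt0// addrC subrK.
  exists y => _; split => //; last by rewrite yx st.
  apply: rsubP => k; have [->|k0] := eqVneq k ord0.
    by rewrite /straighten !upd_iy ly z1.
  by rewrite !upd_rshift// mxE /= upd_rshift.
rewrite nonsep_classE; last exact: (@profile_Cinf).
apply/card_esym/card_set_bijP; exists (fun n => rel (y n)); split.
- move=> n /= nN; exists (y n) => //; have [_ _ e _] := yP n nN; split => // s _.
  by rewrite hcos z1 cos_le1.
- suff lt n n' : (n < n')%N -> (n' < N)%N -> rel (y n) <> rel (y n').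
    move=> n n' /[!inE]/= nN n'N rr; have [n1|n1|//] := ltngtP n n'.
      by have := lt _ _ n1 n'N.
    by have := lt _ _ n1 nN; rewrite rr.
  move=> nn' n'N /same_leafP[_ H].
  have [ly yl _ /andP[_ yn]] := yP n (ltn_trans nn' n'N).
  have [_ _ _ /andP[yn' yE]] := yP n' n'N.
  have nn1 : n.+1%:R * (2 * pi) <= n'%:R * (2 * pi) :> R.
    by apply: ler_wpM2r; [lra|rewrite ler_nat].
  (* The barrier 2 pi (n+1) lies between the two points, and there the profile equals the level
     1. *)
  have [|s st] := surj (n.+1%:R * (2 * pi)).
    have yE' : E * sigm (y n' ord0 ix) < E by rewrite gtr_pMr// sigm_lt1.
    by rewrite mulr_gt0 ?ltr0n//=; lra.
  have s1 : y n ord0 ix < s by rewrite -smono st.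
  have s2 : s < y n' ord0 ix by rewrite -smono st (le_lt_trans nn1).
  have := H s; rewrite yl hcos ly st cos_nat ltxx.
  by rewrite /btw (ltW s1) (ltW s2) => /(_ isT).
- move=> L [z' zz' <-]; have [e _] := zz'.
  have l' : z' ord0 il = z ord0 il by rewrite (rsub_il e).
  have z'1 : lev z' = 1 by rewrite -(rsub_level e).
  pose t := E * sigm (z' ord0 ix).
  have t0 : 0 < t by rewrite mulr_gt0 ?sigm_gt0.
  have tE : t < E by rewrite gtr_pMr// sigm_lt1.
  have ct : cos t < 1 by have := lt_level profile z'; rewrite z'1 l' hcos.
  pose n := Num.truncn (t / (2 * pi)).
  have /andP[n1 n2] : n%:R <= t / (2 * pi) < n.+1%:R.
    by apply: truncn_itv; rewrite divr_ge0//; lra.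
  rewrite ler_pdivlMr in n1; last lra.
  rewrite ltr_pdivrMr in n2; last lra.
  (* t itself is no multiple of 2 pi, because its cosine is less than 1. *)
  have {}n1 : n%:R * (2 * pi) < t.
    rewrite lt_neqAle n1 andbT; apply/eqP => nt.
    by move: ct; rewrite -nt cos_nat ltxx.
  have nN : (n < N)%N.
    rewrite -(ltr_nat R) -(ltr_pM2r pp).
    exact: lt_le_trans (lt_trans n1 tE) EN.
  exists n => //; apply/same_leafP.
  have [ly yl ey /andP[yn1 yn2]] := yP n nN.
  split; first by rewrite -ey.
  move=> s bs; rewrite yl hcos ly; apply: (@cos_lt1 _ n).
  have wm a b : a <= b -> E * sigm a <= E * sigm b.
    by rewrite !le_eqVlt smono => /orP[/eqP -> |->]; rewrite ?eqxx ?orbT.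
  move: bs => /orP[]/andP[/wm s1 /wm s2]; rewrite /t in n1 n2; lra.
Qed.

(** More than two leaves in a class force w(l) = 0 and level 1, so e^l = 2 pi al m and the class has
    ceil(al m) leaves. Conversely each m >= 1 is realized by a point on level 1. *)
Lemma spectrumP (k : nat) : (2 < k)%N ->
  spectrum pfol k <-> exists2 m : nat, (0 < m)%N & k%:R - 1 < al * m%:R <= k%:R.
Proof.
move=> k2; have p0 := pi_gt0 R.
have a0 : 0 < al by exact: lt_le_trans al3.
have aN0 : al != 0 by rewrite gt_eqF.
have slope0 l m : expR l = 2 * pi * (al * m%:R) -> slope l = 0.
  move=> El; rewrite /slope El (_ : _ / _ = 0 + pi *+ m); last first.
    by rewrite add0r -(mulr_natl pi m); field.
  by rewrite (alternatingn (@sinDpi R)) sin0 mulr0.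
have count z m N : (0 < m)%N -> expR (z ord0 il) = 2 * pi * (al * m%:R) ->
    lev z = 1 -> N%:R - 1 < al * m%:R <= N%:R -> (nonsep_class pfol (rel z) #= `I_N)%card.
  move=> m0 Ez z1 /andP[N1 N2]; apply: nonsep_class_card => //.
    exact: slope0 Ez.
  by rewrite Ez ![2 * pi * _]mulrC; apply/andP; split; [rewrite ltr_pM2r|rewrite ler_pM2r]; lra.
split=> [[L [/pfolP[z ->] Lk]]|[m m0 mk]].
- have : slope (z ord0 il) = 0 /\ lev z = 1.
    move: (Lk); rewrite nonsep_classE; last exact: (@profile_Cinf).
    move=> /card_esym/card_set_bijP[f [fI finj _]].
    (* A class of k > 2 leaves contains three distinct ones, those numbered 0, 1 and 2. *)
    have [k0 k1] : (0 < k)%N /\ (1 < k)%N by split; apply: leq_trans k2.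
    have [x zx xf] := fI 0%N k0; have [y zy yf] := fI 1%N k1.
    have [t zt tf] := fI 2%N k2.
    have D i j : (i < k)%N -> (j < k)%N -> i != j -> f i <> f j.
      by move=> ik jk ij fij; move: ij; rewrite (finj i j) ?inE// eqxx.
    have [e _] := zx; rewrite (rsub_il e) (rsub_level e).
    apply: (@three_leaves x y t).
    + exact: touching_trans (touching_sym zx) zy.
    + exact: touching_trans (touching_sym zy) zt.
    + by move/same_leafP; rewrite xf yf; exact: D.
    + by move/same_leafP; rewrite tf yf; exact: D.
    + by move/same_leafP; rewrite xf tf; exact: D.
  move=> [w0 z1].
  have [|m Em] := sin_eq0_nat _ w0.
    by rewrite divr_ge0 ?expR_ge0//; lra.
  have Ez : expR (z ord0 il) = 2 * pi * (al * m%:R).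
    move/(congr1 (fun r => r * (2 * al))): Em; rewrite divfK; last lra.
    by move=> ->; ring.
  have m0 : (0 < m)%N.
    rewrite lt0n; apply/eqP => m0; move: Ez; rewrite m0 !mulr0 => Ez.
    by have := expR_gt0 (z ord0 il); rewrite Ez ltxx.
  have [|N NP] := @natceilP _ (al * m%:R); first by rewrite mulr_gt0 ?ltr0n//; lra.
  exists m => //; suff -> : k = N by [].
  by apply/card_eq_II; apply: card_eq_trans (count z m N _ _ _ NP) => //; exact: card_esym.
- have m0' : 0 < m%:R :> R by rewrite ltr0n.
  pose E : R := 2 * pi * (al * m%:R).
  have E0 : 0 < E by rewrite !mulr_gt0//; lra.
  (* Then E sigm(x) = pi, the profile is -1, and y_1 = ln 2 raises the level to 1. *)
  have [x xE] : exists x : R, sigm x = (2 * (al * m%:R))^-1.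
    have alm : 3 <= al * m%:R.
      by rewrite -[3]mulr1; apply: ler_pM => //; rewrite ler1n.
    by apply: sigm_surj; rewrite invr_gt0 invf_lt1; lra.
  pose z : V := \row_j (if j == ix then x else if j == il then ln E
    else if j == iy then ln 2 else 0).
  have zx : z ord0 ix = x by rewrite mxE.
  have zl : z ord0 il = ln E by rewrite mxE.
  have zy : z ord0 iy = ln 2 by rewrite mxE.
  have Ez : expR (z ord0 il) = E by rewrite zl lnK.
  exists (rel z); split; first by apply/pfolP; exists z.
  apply: (count z m k) => //.
  rewrite /level zx zy lnK ?posrE// /profile /tilt (slope0 _ m) ?Ez//.
  rewrite mul0r add0r xE (_ : E / _ = pi) ?cospi; last by rewrite /E; field; lra.
  by lra.
Qed.

End Profile.

(** * Recovering al from its Beatty numbers *)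

Lemma increasing_range_le (f g : nat -> nat) :
  {homo f : m n / (m < n)%N} -> {homo g : m n / (m < n)%N} -> range f = range g ->
  f = g.
Proof.
move=> fI gI fg; apply/funext; elim/ltn_ind => m IH.
have key (u v : nat -> nat) : {homo u : m n / (m < n)%N} -> {homo v : m n / (m < n)%N} ->
    range u = range v -> (forall i, (i < m)%N -> u i = v i) -> (v m <= u m)%N.
  move=> uI vI uv uvm.
  (* [u m] is a value [v j], and j < m is excluded: there [v j] = [u j] < [u m]. *)
  have [j _ vj] : range v (u m) by rewrite -uv; exists m.
  have [jm|mj] := ltnP j m.
    by have := uI _ _ jm; rewrite (uvm j jm) vj ltnn.
  by rewrite -vj; move: mj; rewrite leq_eqVlt => /orP[/eqP <-|/vI/ltnW].
by apply/eqP; rewrite eqn_leq !key// => i /IH.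
Qed.

(** The elements of the spectrum above 2, in increasing order, are F m = ceil(c (m+1)). For c >= 3
    all these exceed 2 and are strictly increasing in m, so the spectrum determines F, and F
    determines c. *)
Lemma spectrum_inj (R : realType) (al be : R) : 3 <= al -> 3 <= be ->
  spectrum (level_foliation (profile al)) = spectrum (level_foliation (profile be)) -> al = be.
Proof.
move=> al3 be3 E.
have beatty (c : R) : 3 <= c -> exists F : nat -> nat,
    [/\ {homo F : m n / (m < n)%N},
        forall m, (F m)%:R - 1 < c * m.+1%:R <= (F m)%:R &
        range F = [set k | (2 < k)%N /\ spectrum (level_foliation (profile c)) k]].
  move=> c3.
  have /choice[F FP] (m : nat) : exists k : nat, k%:R - 1 < c * m.+1%:R <= k%:R.
    by apply: natceilP; rewrite mulr_gt0 ?ltr0n//; lra.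
  have F2 m : (2 < F m)%N.
    rewrite -(ltr_nat R); have /andP[_] := FP m; apply: lt_le_trans.
    apply: (@lt_le_trans _ _ (3 * 1)); first by rewrite mulr1 ltr_nat.
    by apply: ler_pM => //; rewrite ler1n.
  exists F; split => // [m n mn|].
    rewrite -(ltr_nat R); have /andP[m1 m2] := FP m; have /andP[n1 n2] := FP n.
    have : c * m.+1%:R + 3 <= c * n.+1%:R.
      apply: (@le_trans _ _ (c * m.+2%:R)).
        by rewrite -[in leRHS]natr1 mulrDr mulr1 lerD2l.
      by apply: ler_wpM2l; [lra|rewrite ler_nat].
    lra.
  apply/seteqP; split=> [_ [m _ <-]|k [k2]].
    by split => //; apply/(spectrumP c3 (F2 m)); exists m.+1.
  move=> /(spectrumP c3 k2)[[//|m] _ /andP[k1 k2']].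
  exists m => //; have /andP[m1 m2] := FP m.
  have : (F m < k.+1)%N by rewrite -(ltr_nat R) -natr1; lra.
  have : (k < (F m).+1)%N by rewrite -(ltr_nat R) -natr1; lra.
  by rewrite !ltnS => *; apply/eqP; rewrite eqn_leq; apply/andP.
have [f [fI fP fr]] := beatty al al3; have [g [gI gP gr]] := beatty be be3.
have fg : f = g by apply: increasing_range_le => //; rewrite fr gr E.
(* The bounds give (y - x)(m+1) < 1 for every m, which is impossible for y > x once m+1 > 1/(y -
   x). *)
have close (x y : R) : (forall m : nat, (f m)%:R - 1 < x * m.+1%:R) ->
    (forall m, y * m.+1%:R <= (f m)%:R) -> y <= x.
  move=> Hx Hy; rewrite leNgt; apply/negP => xy.
  pose m := Num.truncn (y - x)^-1.
  have xy0 : 0 < y - x by rewrite subr_gt0.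
  have : (y - x)^-1 < m.+1%:R by exact: truncnS_gt.
  rewrite -(ltr_pM2l xy0) divff ?gt_eqF// => h.
  by have := Hx m; have := Hy m; lra.
apply/eqP; rewrite eq_le; apply/andP; split; apply: close => m.
- by rewrite fg; case/andP: (gP m).
- by case/andP: (fP m).
- by case/andP: (fP m).
- by rewrite fg; case/andP: (gP m).
Qed.

Theorem corollary4 (R : realType) :
  exists S : set (set (set 'rV[R]_(4 + 4))),
    [/\ ~ countable S,
        forall F, S F ->
          @smooth_foliation R 4 4 F /\
          forall L, F L ->
            @lagrangian R 4 L /\ diffeomorphic L [set: 'rV[R]_4]
      & forall F G, S F -> S G -> F <> G -> ~ smoothly_equivalent F G].
Proof.
pose I : set R := [set` `[3, 4]].
have I3 al : I al -> 3 <= al by rewrite /I /= in_itv => /andP[].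
exists [set level_foliation (profile al) | al in I]; split.
- have inj : {in I &, injective (fun al => level_foliation (profile al))}.
    by move=> al be /[!inE] /I3 ? /I3 ? /(congr1 (@spectrum _)); exact: spectrum_inj.
  (* A countable set of parameters would have Lebesgue measure 0, whereas [3, 4] has measure 4 -
     3. *)
  rewrite (eq_countable (inj_card_eq inj)) => /countable_lebesgue_measure0.
  rewrite /I lebesgue_measure_itv/= lte_fin ltr_nat /= -EFinB => /eqP.
  by rewrite eqe subr_eq0 eqr_nat.
- move=> _ [al _ <-]; split; first exact: level_foliation_smooth (@profile_Cinf _ al).
  move=> L /pfolP[z ->]; split.
    exact: leaf_lagrangian (@profile_Cinf _ al) z.
  exact: (leaf_chart (@profile_Cinf _ al) z).1.
- move=> _ _ [al /I3 al3 <-] [be /I3 be3 <-] ab /spectrum_equivalent/(spectrum_inj al3 be3) E.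
  by rewrite E in ab.
Qed.
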